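(* Let $d\ge 2$ and let $\{C_t\}_{t\in\mathbb{R}P^1}$ be a generic real pencil of plane curves of degree $d$ whose $d^2$ base points are distinct, with exactly $2r$ of them non-real (forming $r$ pairs of complex conjugate points), and such that every singular member has exactly one node, which is not a base point. Let $N_{cr}$ be the number of real members whose node is a real non-solitary node (two real branches) and $N_{sol}$ the number of real members whose node is solitary (locally $x^2+y^2=0$ over $\mathbb{R}$). Then $N_{cr}-N_{sol}=d^2-1-2r$. In particular, if all base points are real, the pencil contains at least $d^2-1$ real nodal curves.
   Context: A real pencil is a one-parameter linear family $\{sF+tG\}$ with $F,G$ real homogeneous polynomials of degree $d$; its base points are the common zeros of $F$ and $G$. *)

(* Defs.v *)
From HB Require Import structures.
From mathcomp Require Import all_boot all_order all_algebra.
From mathcomp Require Import reals.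
From mathcomp.real_closed Require Import complex.
From mathcomp.multinomials Require Import mpoly.

Set Implicit Arguments. Unset Strict Implicit. Unset Printing Implicit Defensive.
Import Order.TTheory GRing.Theory Num.Theory.
Local Open Scope ring_scope.

(* Points of the projective plane P^2(K) are represented by nonzero
   homogeneous coordinate triples, up to nonzero scalars. *)
Definition nonzero_pt (K : nzRingType) (p : 'I_3 -> K) := exists i, p i != 0.

Definition proj_eq (K : nzRingType) (p q : 'I_3 -> K) :=
  exists2 l : K, l != 0 & forall i, q i = l * p i.

Definition toC (R : rcfType) (F : {mpoly R[3]}) : {mpoly R[i][3]} :=
  map_mpoly (real_complex R) F.

Definition cpt (R : rcfType) (q : 'I_3 -> R) : 'I_3 -> R[i] :=
  fun i => real_complex R (q i).

Definition real_pt (R : rcfType) (p : 'I_3 -> R[i]) :=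
  exists q : 'I_3 -> R, proj_eq (cpt q) p.

Definition base_pt (R : rcfType) (F G : {mpoly R[3]}) (p : 'I_3 -> R[i]) :=
  [/\ nonzero_pt p, (toC F).@[p] = 0 & (toC G).@[p] = 0].

Definition hessian (K : fieldType) (H : {mpoly K[3]}) (p : 'I_3 -> K) : 'M[K]_3 :=
  \matrix_(i, j) ((H^`M(i))^`M(j)).@[p].

Definition sing_pt (K : fieldType) (H : {mpoly K[3]}) (p : 'I_3 -> K) :=
  [/\ nonzero_pt p, H.@[p] = 0 & forall i, (H^`M(i)).@[p] = 0].

(* node (ordinary double point): singular point whose tangent cone is a
   nondegenerate quadric, i.e. the projective Hessian has rank 2 *)
Definition node_pt (K : fieldType) (H : {mpoly K[3]}) (p : 'I_3 -> K) :=
  sing_pt H p /\ \rank (hessian H p) = 2%N.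

Definition qform (R : nzRingType) (M : 'M[R]_3) (v : 'I_3 -> R) : R :=
  \sum_(i < 3) \sum_(j < 3) v i * M i j * v j.

(* real node with two real branches: tangent cone indefinite *)
Definition crossing_node (R : realFieldType) (H : {mpoly R[3]}) (p : 'I_3 -> R) :=
  node_pt H p /\
  exists v w : 'I_3 -> R, qform (hessian H p) v < 0 /\ 0 < qform (hessian H p) w.

(* solitary real node (locally x^2 + y^2 = 0): tangent cone definite *)
Definition solitary_node (R : realFieldType) (H : {mpoly R[3]}) (p : 'I_3 -> R) :=
  node_pt H p /\
  ((forall v, 0 <= qform (hessian H p) v) \/ (forall v, qform (hessian H p) v <= 0)).

(* real members, parametrized by RP^1 = R u {oo}: Some t |-> F + tG, None |-> G *)
Definition rmember (R : nzRingType) (F G : {mpoly R[3]}) (x : option R) : {mpoly R[3]} :=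
  match x with Some t => F + t *: G | None => G end.

Definition cmember (R : rcfType) (F G : {mpoly R[3]}) (s t : R[i]) : {mpoly R[i][3]} :=
  s *: toC F + t *: toC G.

Definition crossing_member (R : rcfType) (F G : {mpoly R[3]}) (x : option R) :=
  exists p : 'I_3 -> R, crossing_node (rmember F G x) p.

Definition solitary_member (R : rcfType) (F G : {mpoly R[3]}) (x : option R) :=
  exists p : 'I_3 -> R, solitary_node (rmember F G x) p.

Definition nodal_member (R : rcfType) (F G : {mpoly R[3]}) (x : option R) :=
  exists p : 'I_3 -> R[i], node_pt (toC (rmember F G x)) p.

(* Main.v *)
(** Multiply out the differential of F/G: the field V = F grad G - G grad F is
    homogeneous of odd degree and, by Euler's identity, orthogonal to the
    position vector, so it defines a tangent field on RP^2.  Its real zeros are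
    the real base points and the nodes of the real members.  At a base point
    DV = dF ^ dG is skew, so the index is +1; at a node of H = sF + tG one has
    DV = k Hess H, so the index is +1 for a solitary node and -1 for a crossing.
    Poincare-Hopf on RP^2 then reads (d^2 - 2r) + N_sol - N_cr = 1.

    Poincare-Hopf is proved by discrete winding numbers.  RP^2 is covered by
    four squares (t, s), the cones over the four edges of the diamond
    |c1| + |c2| = 1 in the plane spanned by u1, u2, with apex u3.  On a fine grid
    the half turns of the field around the boundary of a square are the sum of
    those around the cells, which vanish away from the zeros and give twice the
    sign of the Jacobian near a zero.  In the radial/angular frame the seams
    between consecutive squares cancel, the sides on the line u1 u2 cancel
    between opposite squares because the antipodal map mirrors the frame, and
    the four sides collapsed to u3 contribute one full turn. *)
Require Import Defs.
From HB Require Import structures.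
From mathcomp Require Import all_boot all_order all_algebra.
From mathcomp Require Import boolp classical_sets reals.
From mathcomp.real_closed Require Import complex.
From mathcomp Require Import ring lra zify.
From mathcomp.multinomials Require Import mpoly.
Set Implicit Arguments. Unset Strict Implicit. Unset Printing Implicit Defensive.
Import Order.TTheory GRing.Theory Num.Theory.
Local Open Scope ring_scope.

(** * Discrete winding numbers *)

(** No angle is ever measured: turning is an integer that counts crossings of one axis, so only
    signs of field values and of their cross products matter. The price is that the field must not
    vanish on the sides of the squares. These sides lie on the three lines through pairs of [u1],
    [u2], [u3], so the basis is chosen to keep every zero off those lines; that choice needs
    finiteness of the zeros, obtained beforehand from nondegeneracy and compactness in three affine
    charts. The index at a zero [x] is the sign of [minor2 (jac V x) p q] for [p, q] complementary
    to [x]. Nondegeneracy comes from rank 2 at the nodes, and at base points from the fact that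
    dependent gradients would make some member singular there. The node hypothesis is complex while
    the field is real. A real member has at most one complex singular point, which conjugation must
    then fix, so the field sees every node of a real member. *)

Section HalfTurn.
Variable R : realType.
Implicit Types a b l : R * R.

Definition dot2 l a : R := l.1 * a.1 + l.2 * a.2.
Definition up a : int := (nat_of_bool (0 < a.2)%R)%:Z.
(* Signed number of crossings of the horizontal axis when turning from a to b
   through the angle smaller than pi; vectors on the axis count as lying below
   it.  A full turn is worth 2. *)
Definition hturn a b : int :=
  if (0 < a.2) == (0 < b.2) then 0 else sgz (a.1 * b.2 - a.2 * b.1).

(* In an open half plane hturn is a coboundary: this makes paths telescope. *)
Lemma hturn_half l a b : 0 < dot2 l a -> 0 < dot2 l b ->
  hturn a b = sgz l.1 * (up b - up a).
Proof.
rewrite /dot2 /hturn /up; case: l a b => [l1 l2] [a1 a2] [b1 b2] /= la lb.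
(* The cross product times [l1] is expressed through the two positive values of [l], so opposite
   positions of [a] and [b] determine its sign. *)
have key : l1 * (a1 * b2 - a2 * b1)
           = (l1 * a1 + l2 * a2) * b2 - (l1 * b1 + l2 * b2) * a2 by ring.
case: (ltP 0 a2) => Ha; case: (ltP 0 b2) => Hb /=; rewrite ?subrr ?mulr0 //.
- have K : l1 * (a1 * b2 - a2 * b1) < 0 by rewrite key; nra.
  case: (ltrgtP l1 0) => Hl; last by move: K; rewrite Hl mul0r ltxx.
  + by rewrite (ltr0_sgz Hl) gtr0_sgz; [|nra].
  + by rewrite (gtr0_sgz Hl) ltr0_sgz; [|nra].
- have K : 0 < l1 * (a1 * b2 - a2 * b1) by rewrite key; nra.
  case: (ltrgtP l1 0) => Hl; last by move: K; rewrite Hl mul0r ltxx.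
  + by rewrite (ltr0_sgz Hl) ltr0_sgz; [|nra].
  + by rewrite (gtr0_sgz Hl) gtr0_sgz; [|nra].
Qed.

Lemma hturn_mirror a b : hturn (- a.1, a.2) (- b.1, b.2) = - hturn a b.
Proof.
rewrite /hturn /=; case: ifP => _; first by rewrite oppr0.
by rewrite -sgzN; congr sgz; ring.
Qed.

Lemma sum_hturn_half (u : nat -> R * R) l m n : (m <= n)%N ->
  (forall i, (m <= i <= n)%N -> 0 < dot2 l (u i)) ->
  \sum_(m <= i < n) hturn (u i) (u i.+1) = hturn (u m) (u n).
Proof.
move=> mn H; rewrite (@hturn_half l) ?H ?leqnn ?mn //.
rewrite -(@telescope_sumr _ _ _ (fun i => up (u i))) // big_distrr /=.
apply: eq_big_nat => i /andP[mi ni]; apply: hturn_half; apply: H; lia.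
Qed.

Definition hstep (u : nat -> nat -> R * R) i j := hturn (u i j) (u i.+1 j).
Definition vstep (u : nat -> nat -> R * R) i j := hturn (u i j) (u i j.+1).
(** The boundary is run counterclockwise, the first index being horizontal; [bdry] follows the same
    convention for a block of cells. *)
Definition cell (u : nat -> nat -> R * R) i j :=
  hstep u i j + vstep u i.+1 j - hstep u i j.+1 - vstep u i j.
Definition bdry (u : nat -> nat -> R * R) (a b c d : nat) : int :=
  \sum_(a <= i < b) (hstep u i c - hstep u i d)
  + \sum_(c <= j < d) (vstep u b j - vstep u a j).

(** Discrete Green formula: an edge shared by two cells is run in opposite directions, so both
    families of steps telescope. *)
Lemma sum_cell u (a b c d : nat) : (a <= b)%N -> (c <= d)%N ->
  \sum_(a <= i < b) \sum_(c <= j < d) cell u i j = bdry u a b c d.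
Proof.
move=> ab cd; rewrite /bdry.
have -> : \sum_(c <= j < d) (vstep u b j - vstep u a j)
  = \sum_(a <= i < b) \sum_(c <= j < d) (vstep u i.+1 j - vstep u i j).
  by rewrite exchange_big /=; apply: eq_big_nat => j _; rewrite telescope_sumr.
rewrite -big_split /=; apply: eq_big_nat => i _.
have -> : hstep u i c - hstep u i d = \sum_(c <= j < d) (hstep u i j - hstep u i j.+1).
  rewrite -[LHS]opprB -telescope_sumr // -sumrN.
  by apply: eq_big_nat => j _; rewrite opprB.
by rewrite -big_split /=; apply: eq_big_nat => j _; rewrite /cell; ring.
Qed.

Lemma cell_half u l i j :
  0 < dot2 l (u i j) -> 0 < dot2 l (u i.+1 j) ->
  0 < dot2 l (u i j.+1) -> 0 < dot2 l (u i.+1 j.+1) -> cell u i j = 0.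
Proof.
move=> h1 h2 h3 h4; rewrite /cell /hstep /vstep.
by rewrite !(@hturn_half l) //; ring.
Qed.

(** The four vectors lie in the four open quadrants, so each side of the quadrilateral stays in a
    coordinate half plane. Its image stays in a half plane too, where turning is a coboundary; the
    total then depends only on which corners are mapped above the axis. *)
Lemma hturn_linear_loop (a b c d : R) (A B C D : R * R) :
  let m v := (a * v.1 + b * v.2, c * v.1 + d * v.2) in
  a * d - b * c != 0 ->
  A.1 < 0 -> A.2 < 0 -> 0 < B.1 -> B.2 < 0 ->
  0 < C.1 -> 0 < C.2 -> D.1 < 0 -> 0 < D.2 ->
  hturn (m A) (m B) + hturn (m B) (m C) - hturn (m D) (m C) - hturn (m A) (m D)
    = 2 * sgz (a * d - b * c).
Proof.
case: A B C D => [A1 A2] [B1 B2] [C1 C2] [D1 D2] m /= D0 *.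
set Dt := a * d - b * c in D0 *.
have D2_gt0 : 0 < Dt * Dt by rewrite -expr2 exprn_even_gt0.
(* The covectors are [Dt] times the rows of the adjugate of [m], up to sign; they pull back to a
   nonzero multiple, of known sign, of one coordinate. *)
have r1 v : dot2 (Dt * d, - (Dt * b)) (m v) = (Dt * Dt) * v.1.
  by rewrite /dot2 /m /Dt /=; ring.
have r2 v : dot2 (- (Dt * c), Dt * a) (m v) = (Dt * Dt) * v.2.
  by rewrite /dot2 /m /Dt /=; ring.
have r1' v : dot2 (- (Dt * d), Dt * b) (m v) = - (Dt * Dt * v.1).
  by rewrite -r1 /dot2 /=; ring.
have r2' v : dot2 (Dt * c, - (Dt * a)) (m v) = - (Dt * Dt * v.2).
  by rewrite -r2 /dot2 /=; ring.
rewrite (@hturn_half (Dt * c, - (Dt * a)) (m (A1, A2)) (m (B1, B2))) ?r2' /=; try nra.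
rewrite (@hturn_half (Dt * d, - (Dt * b)) (m (B1, B2)) (m (C1, C2))) ?r1 /=; try nra.
rewrite (@hturn_half (- (Dt * c), Dt * a) (m (D1, D2)) (m (C1, C2))) ?r2 /=; try nra.
rewrite (@hturn_half (- (Dt * d), Dt * b) (m (A1, A2)) (m (D1, D2))) ?r1' /=; try nra.
rewrite !sgzN !sgzM /up /m /=.
have gt1 (x : R) : 0 < x -> (0 < x) = true by [].
have lt1 (x : R) : x < 0 -> (0 < x) = false by move=> h; rewrite ltNge ltW.
have gt2 (x y : R) : 0 < x -> 0 < y -> (0 < x + y) = true by exact: addr_gt0.
have lt2 (x y : R) : x < 0 -> y < 0 -> (0 < x + y) = false.
  by move=> hx hy; apply: lt1; rewrite -[0]addr0 ltrD.
(* The second coordinate of [m v] is [c * v.1 + d * v.2]. If [c] and [d] are nonzero, its sign is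
   known at two opposite corners; the other two enter the sum with coefficient zero, so either value
   is allowed there. *)
have cs : (c < 0 /\ [/\ 0 < c * A1, c * B1 < 0, c * C1 < 0 & 0 < c * D1]) \/
  (0 < c /\ [/\ c * A1 < 0, 0 < c * B1, 0 < c * C1 & c * D1 < 0]) \/ c = 0.
  have [c0|c0|c0] := ltrgtP c 0; [left|right; left|by right; right];
    by split=> //; split; nra.
have ds : (d < 0 /\ [/\ 0 < d * A2, 0 < d * B2, d * C2 < 0 & d * D2 < 0]) \/
  (0 < d /\ [/\ d * A2 < 0, d * B2 < 0, 0 < d * C2 & 0 < d * D2]) \/ d = 0.
  have [d0|d0|d0] := ltrgtP d 0; [left|right; left|by right; right];
    by split=> //; split; nra.
case: cs => [[c0 [? ? ? ?]]|[[c0 [? ? ? ?]]|c0]];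
  case: ds => [[d0 [? ? ? ?]]|[[d0 [? ? ? ?]]|d0]].
all: rewrite ?(ltr0_sgz c0) ?(ltr0_sgz d0) ?(gtr0_sgz c0) ?(gtr0_sgz d0).
all: try by move: D0; rewrite /Dt c0 d0 !mulr0 subrr eqxx.
all: rewrite ?c0 ?d0 ?sgz0 ?mul0r ?add0r ?addr0.
all: first [rewrite (@gt2 (_ * A1)); [|assumption|assumption] | rewrite (@lt2 (_ * A1)); [|assumption|assumption]
  | rewrite (@gt1 (_ * A1)); [|assumption] | rewrite (@lt1 (_ * A1)); [|assumption]
  | rewrite (@gt1 (_ * A2)); [|assumption] | rewrite (@lt1 (_ * A2)); [|assumption]
  | case: (0 < _ * A1 + _)].
all: first [rewrite (@gt2 (_ * B1)); [|assumption|assumption] | rewrite (@lt2 (_ * B1)); [|assumption|assumption]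
  | rewrite (@gt1 (_ * B1)); [|assumption] | rewrite (@lt1 (_ * B1)); [|assumption]
  | rewrite (@gt1 (_ * B2)); [|assumption] | rewrite (@lt1 (_ * B2)); [|assumption]
  | case: (0 < _ * B1 + _)].
all: first [rewrite (@gt2 (_ * C1)); [|assumption|assumption] | rewrite (@lt2 (_ * C1)); [|assumption|assumption]
  | rewrite (@gt1 (_ * C1)); [|assumption] | rewrite (@lt1 (_ * C1)); [|assumption]
  | rewrite (@gt1 (_ * C2)); [|assumption] | rewrite (@lt1 (_ * C2)); [|assumption]
  | case: (0 < _ * C1 + _)].
all: first [rewrite (@gt2 (_ * D1)); [|assumption|assumption] | rewrite (@lt2 (_ * D1)); [|assumption|assumption]
  | rewrite (@gt1 (_ * D1)); [|assumption] | rewrite (@lt1 (_ * D1)); [|assumption]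
  | rewrite (@gt1 (_ * D2)); [|assumption] | rewrite (@lt1 (_ * D2)); [|assumption]
  | case: (0 < _ * D1 + _)].
all: rewrite /=; ring.
Qed.

(** Four clockwise quarter turns, crossing the axis twice. This is how a fixed nonzero vector
    appears in a frame that makes one full positive turn. *)
Lemma hturn_rot_loop (p q : R) : (p != 0) || (q != 0) ->
  hturn (p, q) (q, - p) + hturn (q, - p) (- p, - q)
  + hturn (- p, - q) (- q, p) + hturn (- q, p) (p, q) = - 2.
Proof.
move=> pq; rewrite /hturn /=.
have N : - (p * p + q * q) < 0.
  by rewrite oppr_lt0 -!expr2; case/orP: pq => h;
     [apply: ltr_pwDl | apply: ltr_wpDl]; rewrite ?sqr_ge0 // exprn_even_gt0.
have -> : p * - p - q * q = - (p * p + q * q) by ring.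
have -> : q * - q - - p * - p = - (p * p + q * q) by ring.
have -> : - p * p - - q * - q = - (p * p + q * q) by ring.
have -> : - q * q - p * p = - (p * p + q * q) by ring.
rewrite (ltr0_sgz N) !oppr_gt0.
have [p0|p0|p0] := ltrgtP p 0; have [q0|q0|q0] := ltrgtP q 0 => //.
by case/orP: pq => /eqP[].
Qed.
End HalfTurn.

(** * Uniformity on the unit square *)

Section Uniform.
Variable R : realType.

(** Compactness of the unit interval in Lebesgue number form. The set of [b] for which one [e]
    serves all of [0, b] is pushed past its supremum by the local hypothesis there, unless it
    reaches 1. *)
Lemma uniform_interval (Q : R -> R -> Prop) :
  (forall x e e', Q x e -> 0 < e' -> e' <= e -> Q x e') ->
  (forall x, 0 <= x <= 1 ->
     exists2 d : R, 0 < d & forall y, 0 <= y <= 1 -> `|y - x| < d -> Q y d) ->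
  exists2 e : R, 0 < e & forall y, 0 <= y <= 1 -> Q y e.
Proof.
move=> Qmono Qloc.
pose S : set R := fun b => 0 <= b <= 1 /\
  exists2 e : R, 0 < e & forall y, 0 <= y <= b -> Q y e.
have S0 : S 0.
  split; first by lra.
  have [|d d0 H] := Qloc 0; first by lra.
  exists d => // y y0; apply: H; first by lra.
  by rewrite (_ : y - 0 = 0) ?normr0 //; lra.
have hS : has_sup S by split; [exists 0 | exists 1 => b [/andP[]]].
have sub b : S b -> b <= sup S by move=> Sb; apply: sup_upper_bound.
have s0 : 0 <= sup S by apply: sub.
have s1 : sup S <= 1 by apply: ge_sup; [exists 0 | move=> b [/andP[]]].
have [|d d0 Hd] := Qloc (sup S); first by lra.
have [b [b01 [e e0 He]] sb] := sup_adherent d0 hS.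
pose m := Num.min e d.
have m0 : 0 < m by rewrite lt_min e0 d0.
have Sm : S (Num.min 1 (sup S + d / 2)).
  split; first by rewrite le_min ge_min lexx /=; lra.
  exists m => // y; rewrite le_min => /and3P[y0 y1 ys].
  have [yb|by_] := lerP y b.
    by apply: Qmono (He y _) m0 _; [lra | rewrite ge_min lexx].
  apply: Qmono (Hd y _ _) m0 _; [lra | | by rewrite ge_min lexx orbT].
  by rewrite ltr_norml; lra.
case: Sm (sub _ Sm) => _ [e' e'0 He'].
rewrite ge_min => /orP[h1|h2]; last by lra.
exists e' => // y y01; apply: He'; rewrite le_min; lra.
Qed.

Lemma uniform_square (Q : R -> R -> R -> Prop) :
  (forall x y e e', Q x y e -> 0 < e' -> e' <= e -> Q x y e') ->
  (forall x y, 0 <= x <= 1 -> 0 <= y <= 1 ->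
     exists2 d : R, 0 < d & forall x' y', 0 <= x' <= 1 -> 0 <= y' <= 1 ->
       `|x' - x| < d -> `|y' - y| < d -> Q x' y' d) ->
  exists2 e : R, 0 < e & forall x y, 0 <= x <= 1 -> 0 <= y <= 1 -> Q x y e.
Proof.
move=> Qmono Qloc.
have [|x x01|e e0 He] :=
  @uniform_interval (fun x e => forall y, 0 <= y <= 1 -> Q x y e); last by exists e => // x y; auto.
  by move=> x e e' H e'0 ee' y y01; apply: Qmono (H y y01) e'0 ee'.
(* Tube argument: at fixed [x], compactness in [y] gives one width [e] for a whole strip around the
   segment over [x]. *)
have [||e e0 He] := @uniform_interval (fun y e => forall x', 0 <= x' <= 1 -> `|x' - x| < e -> Q x' y e).
- move=> y e e' H e'0 ee' x' x'01 xx'; apply: (Qmono _ _ _ _ (H x' x'01 _) e'0 ee').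
  exact: lt_le_trans xx' ee'.
- move=> y y01; have [d d0 H] := Qloc x y x01 y01.
  by exists d => // y' y'01 yy' x' x'01 xx'; apply: H.
by exists e => // x' x'01 xx' y y01; apply: He.
Qed.

End Uniform.

(** * First order expansions with quadratic remainder *)

Section Diff.
Variable R : realType.
Implicit Types (g h : R -> R -> R) (x y X Y : R).

(** A quadratic remainder on a fixed box makes the sum and product rules purely algebraic and yields
    explicit radii. *)
Definition diff2 g x y gx gy := exists2 C, 0 <= C &
  forall X Y, `|X| <= 1 -> `|Y| <= 1 ->
    `|g (x + X) (y + Y) - g x y - (gx * X + gy * Y)| <= C * (`|X| + `|Y|) ^+ 2.

Lemma diff2_cst (c : R) x y : diff2 (fun _ _ => c) x y 0 0.
Proof.
exists 0 => // X Y _ _.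
by rewrite (_ : c - c - _ = 0) ?normr0 ?mul0r //; ring.
Qed.

Lemma diff2_fst x y : diff2 (fun x _ => x) x y 1 0.
Proof. by exists 0 => // X Y _ _; rewrite (_ : _ - _ - _ = 0) ?normr0 ?mul0r //; ring. Qed.

Lemma diff2_snd x y : diff2 (fun _ y => y) x y 0 1.
Proof. by exists 0 => // X Y _ _; rewrite (_ : _ - _ - _ = 0) ?normr0 ?mul0r //; ring. Qed.

Lemma diff2_eq g x y gx gy gx' gy' :
  diff2 g x y gx gy -> gx = gx' -> gy = gy' -> diff2 g x y gx' gy'.
Proof. by move=> H <- <-. Qed.

Lemma diff2D g h x y gx gy hx hy : diff2 g x y gx gy -> diff2 h x y hx hy ->
  diff2 (fun x y => g x y + h x y) x y (gx + hx) (gy + hy).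
Proof.
move=> [C C0 HC] [D D0 HD]; exists (C + D); first exact: addr_ge0.
move=> X Y hX hY; rewrite [X in _ <= X]mulrDl.
have -> : g (x + X) (y + Y) + h (x + X) (y + Y) - (g x y + h x y)
   - ((gx + hx) * X + (gy + hy) * Y)
   = (g (x + X) (y + Y) - g x y - (gx * X + gy * Y))
   + (h (x + X) (y + Y) - h x y - (hx * X + hy * Y)) by ring.
by apply: le_trans (ler_normD _ _) (lerD _ _); auto.
Qed.

Lemma diff2_lip g x y gx gy : diff2 g x y gx gy ->
  exists2 K, 0 <= K & forall X Y, `|X| <= 1 -> `|Y| <= 1 ->
    `|g (x + X) (y + Y) - g x y| <= K * (`|X| + `|Y|).
Proof.
move=> [C C0 H]; exists (`|gx| + `|gy| + 2 * C) => [|X Y hX hY].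
  by rewrite !addr_ge0 ?mulr_ge0.
have -> : g (x + X) (y + Y) - g x y =
  (g (x + X) (y + Y) - g x y - (gx * X + gy * Y)) + (gx * X + gy * Y) by ring.
apply: le_trans (ler_normD _ _) _.
apply: le_trans (lerD (H _ _ hX hY) (ler_normD _ _)) _.
rewrite !normrM expr2.
have hX0 := normr_ge0 X; have hY0 := normr_ge0 Y.
have a0 := normr_ge0 gx; have b0 := normr_ge0 gy.
set A := `|gx| in a0 *; set B := `|gy| in b0 *; set P := `|X| in hX hX0 *; set S := `|Y| in hY hY0 *.
have : C * ((P + S) * (P + S)) <= C * (2 * (P + S)).
  by rewrite ler_wpM2l // ler_wpM2r //; lra.
by have := mulr_ge0 a0 hY0; have := mulr_ge0 b0 hX0; lra.
Qed.

Lemma diff2M g h x y gx gy hx hy : diff2 g x y gx gy -> diff2 h x y hx hy ->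
  diff2 (fun x y => g x y * h x y) x y (gx * h x y + g x y * hx) (gy * h x y + g x y * hy).
Proof.
move=> dg dh; have [K K0 HK] := diff2_lip dg; have [L L0 HL] := diff2_lip dh.
case: dg dh => [C C0 HC] [D D0 HD].
exists (C * `|h x y| + `|g x y| * D + K * L) => [|X Y hX hY].
  by rewrite !addr_ge0 // mulr_ge0.
have -> : g (x + X) (y + Y) * h (x + X) (y + Y) - g x y * h x y
   - ((gx * h x y + g x y * hx) * X + (gy * h x y + g x y * hy) * Y)
   = (g (x + X) (y + Y) - g x y - (gx * X + gy * Y)) * h x y
   + g x y * (h (x + X) (y + Y) - h x y - (hx * X + hy * Y))
   + (g (x + X) (y + Y) - g x y) * (h (x + X) (y + Y) - h x y) by ring.
have -> : (C * `|h x y| + `|g x y| * D + K * L) * (`|X| + `|Y|) ^+ 2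
  = C * (`|X| + `|Y|) ^+ 2 * `|h x y| + `|g x y| * (D * (`|X| + `|Y|) ^+ 2)
    + (K * (`|X| + `|Y|)) * (L * (`|X| + `|Y|)) by ring.
apply: le_trans (ler_normD _ _) (lerD (le_trans (ler_normD _ _) (lerD _ _)) _).
- by rewrite normrM ler_wpM2r // HC.
- by rewrite normrM ler_wpM2l // HD.
- by rewrite normrM ler_pM // ?HK ?HL.
Qed.

Lemma diff2B g h x y gx gy hx hy :
  diff2 g x y gx gy -> diff2 h x y hx hy ->
  diff2 (fun x y => g x y - h x y) x y (gx - hx) (gy - hy).
Proof.
move=> dg dh; under eq_fun do under eq_fun do rewrite -mulN1r.
by apply: (diff2_eq (diff2D dg (diff2M (diff2_cst (-1) x y) dh))); ring.
Qed.

Lemma diff2_sum n (G : 'I_n -> R -> R -> R) (Gx Gy : 'I_n -> R) x y :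
  (forall i, diff2 (G i) x y (Gx i) (Gy i)) ->
  diff2 (fun x y => \sum_i G i x y) x y (\sum_i Gx i) (\sum_i Gy i).
Proof.
elim: n G Gx Gy => [|n IH] G Gx Gy H.
  by under eq_fun do under eq_fun do rewrite big_ord0; rewrite !big_ord0; apply: diff2_cst.
under eq_fun do under eq_fun do rewrite big_ord_recr /=.
rewrite !big_ord_recr /=; apply: diff2D => //.
by apply: IH => i.
Qed.

(** By the Lipschitz bound the field stays in the open half plane defined by its own value at the
    centre. *)
Lemma diff2_near_neq0 (f1 f2 : R -> R -> R) x y a b c d :
  diff2 f1 x y a b -> diff2 f2 x y c d -> ~ (f1 x y = 0 /\ f2 x y = 0) ->
  exists2 e : R, 0 < e & forall X Y, `|X| < e -> `|Y| < e ->
    0 < dot2 (f1 x y, f2 x y) (f1 (x + X) (y + Y), f2 (x + X) (y + Y)).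
Proof.
move=> /diff2_lip[K K0 HK] /diff2_lip[L L0 HL] nz.
pose n := f1 x y ^+ 2 + f2 x y ^+ 2.
have n0 : 0 < n.
  rewrite /n lt_neqAle eq_sym paddr_eq0 ?sqr_ge0 // !sqrf_eq0 addr_ge0 ?sqr_ge0 // andbT.
  by apply/negP => /andP[/eqP ? /eqP ?]; apply: nz.
pose M := `|f1 x y| * K + `|f2 x y| * L.
have M0 : 0 <= M by rewrite addr_ge0 // mulr_ge0.
(* The sum of the two displacements is below twice the second entry, so [M] times it is below [n];
   the 1 added to [M] avoids a zero denominator. *)
pose e := Num.min 1 (n / (2 * (M + 1))).
have e0 : 0 < e by rewrite lt_min ltr01 divr_gt0 //; lra.
exists e => // X Y; rewrite !lt_min => /andP[hX hXe] /andP[hY hYe].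
have k1 := HK X Y (ltW hX) (ltW hY); have k2 := HL X Y (ltW hX) (ltW hY).
have -> : dot2 (f1 x y, f2 x y) (f1 (x + X) (y + Y), f2 (x + X) (y + Y))
  = n + (f1 x y * (f1 (x + X) (y + Y) - f1 x y) + f2 x y * (f2 (x + X) (y + Y) - f2 x y)).
  by rewrite /dot2 /n /=; ring.
set T := (X in n + X).
have hT : `|T| <= M * (`|X| + `|Y|).
  apply: le_trans (ler_normD _ _) _; rewrite !normrM /M mulrDl -!mulrA.
  by apply: lerD; apply: ler_wpM2l.
have : M * (`|X| + `|Y|) < n.
  have : M * (`|X| + `|Y|) <= (M + 1) * (`|X| + `|Y|) by rewrite ler_wpM2r ?addr_ge0 //; lra.
  move=> /le_lt_trans; apply.
  have M1 : 0 < M + 1 by lra.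
  rewrite -ltr_pdivlMl //.
  have -> : (M + 1)^-1 * n = n / (2 * (M + 1)) + n / (2 * (M + 1)) by field; lra.
  lra.
have := ler_norm (- T); rewrite normrN; lra.
Qed.

(** Near a nondegenerate zero the field is its linear part applied to a perturbed displacement
    [(g1, g2)]. The relative error 1/8 makes the perturbation at most [e / 4] on a box of radius
    [e], too small to change the sign of a coordinate of size [e / 2]. *)
Lemma diff2_zero_lin (f1 f2 : R -> R -> R) x y a b c d :
  diff2 f1 x y a b -> diff2 f2 x y c d -> f1 x y = 0 -> f2 x y = 0 ->
  a * d - b * c != 0 ->
  exists2 e : R, 0 < e & forall X Y, `|X| <= e -> `|Y| <= e ->
    exists g1 g2 : R, [/\ f1 (x + X) (y + Y) = a * g1 + b * g2,
      f2 (x + X) (y + Y) = c * g1 + d * g2,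
      `|g1 - X| <= (`|X| + `|Y|) / 8 & `|g2 - Y| <= (`|X| + `|Y|) / 8].
Proof.
move=> [C C0 HC] [D D0 HD] z1 z2; set Dt := a * d - b * c => Dt0.
(* [K] bounds both rows of the inverse linear part applied to the remainders; as [S] is at most
   [2 * e], the radius below gives [K * S ^+ 2 <= S / 8]. *)
pose K := (`|d| * C + `|b| * D + `|c| * C + `|a| * D) / `|Dt|.
have K0 : 0 <= K by rewrite divr_ge0 // !addr_ge0 ?mulr_ge0.
pose e := Num.min 1 ((16 * (K + 1))^-1).
have e0 : 0 < e by rewrite lt_min ltr01 invr_gt0; lra.
exists e => // X Y; rewrite !le_min => /andP[hX hXe] /andP[hY hYe].
have k1 := HC X Y hX hY; have k2 := HD X Y hX hY; move: k1 k2.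
rewrite z1 z2 !subr0.
set p := f1 _ _; set q := f2 _ _; set S := `|X| + `|Y|.
set r1 := p - _; set r2 := q - _ => k1 k2.
have S0 : 0 <= S by rewrite addr_ge0.
have KS : K * S ^+ 2 <= S / 8.
  rewrite expr2 mulrA [S / 8]mulrC ler_wpM2r //.
  have : K * S <= (K + 1) * S by rewrite ler_wpM2r //; lra.
  move=> /le_trans; apply.
  have K1 : 0 < K + 1 by lra.
  rewrite -ler_pdivlMl // -invfM.
  have -> : ((K + 1) * 8)^-1 = (16 * (K + 1))^-1 + (16 * (K + 1))^-1 by field; lra.
  exact: lerD.
have bnd (u v : R) : `|u * r1 + v * r2| <= (`|u| * C + `|v| * D) * S ^+ 2.
  apply: le_trans (ler_normD _ _) _; rewrite !normrM mulrDl -!mulrA.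
  by apply: lerD; apply: ler_wpM2l.
have nD : 0 < `|Dt| by rewrite normr_gt0.
have fin (u v : R) : `|u| * C + `|v| * D <= K * `|Dt| -> `|(u * r1 + v * r2) / Dt| <= S / 8.
  move=> h; apply: le_trans KS; rewrite normrM normfV ler_pdivrMr //.
  apply: le_trans (bnd _ _) _; rewrite mulrAC ler_wpM2r ?sqr_ge0 //.
have KD : K * `|Dt| = `|d| * C + `|b| * D + `|c| * C + `|a| * D.
  by rewrite /K divfK // gt_eqF.
have P1 := mulr_ge0 (normr_ge0 d) C0; have P2 := mulr_ge0 (normr_ge0 b) D0.
have P3 := mulr_ge0 (normr_ge0 c) C0; have P4 := mulr_ge0 (normr_ge0 a) D0.
exists ((d * p - b * q) / Dt), ((- c * p + a * q) / Dt); split.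
- by rewrite /Dt; field.
- by rewrite /Dt; field.
- have -> : (d * p - b * q) / Dt - X = (d * r1 + (- b) * r2) / Dt.
    by rewrite /r1 /r2 /Dt; field.
  by apply: fin; rewrite KD normrN; lra.
- have -> : (- c * p + a * q) / Dt - Y = (- c * r1 + a * r2) / Dt.
    by rewrite /r1 /r2 /Dt; field.
  by apply: fin; rewrite KD normrN; lra.
Qed.

End Diff.

Ltac diff2_rec := lazymatch goal with
  | |- diff2 (fun _ _ => ?c) _ _ _ _ => apply (diff2_cst c)
  | |- diff2 (fun x _ => x) _ _ _ _ => apply diff2_fst
  | |- diff2 (fun _ y => y) _ _ _ _ => apply diff2_snd
  | |- diff2 (fun x y => @?g x y - @?h x y) _ _ _ _ => apply (@diff2B _ g h); diff2_rec
  | |- diff2 (fun x y => @?g x y + @?h x y) _ _ _ _ => apply (@diff2D _ g h); diff2_rec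
  | |- diff2 (fun x y => @?g x y * @?h x y) _ _ _ _ => apply (@diff2M _ g h); diff2_rec
  end.
Ltac diff2_poly := eapply diff2_eq; [diff2_rec | rewrite /=; ring | rewrite /=; ring].


(** * Boundary winding and Jacobian signs on the unit square *)

Section Planar.
Variable R : realType.

Lemma sum_nat_if (F : nat -> int) a b N : (b <= N)%N ->
  \sum_(0 <= i < N) (if (a <= i < b)%N then F i else 0) = \sum_(a <= i < b) F i.
Proof.
move=> bN; rewrite -big_mkcond (big_nat_widenl a 0) // (big_nat_widen 0 b N) //.
Qed.

Lemma seq_uniform (T : eqType) (s : seq T) (P : T -> R -> Prop) :
  (forall z e e', P z e -> 0 < e' -> e' <= e -> P z e') ->
  (forall z, z \in s -> exists2 e : R, 0 < e & P z e) ->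
  exists2 e : R, 0 < e & forall z, z \in s -> P z e.
Proof.
move=> mono; elim: s => [|z s IH] H; first by exists 1.
have [|e e0 He] := IH; first by move=> w ws; apply: H; rewrite inE ws orbT.
have [|e' e'0 He'] := H z; first by rewrite inE eqxx.
have m0 : 0 < Num.min e e' by rewrite lt_min e0.
exists (Num.min e e') => // w; rewrite inE => /orP[/eqP->|ws].
  by apply: mono He' m0 _; rewrite ge_min lexx orbT.
by apply: mono (He w ws) m0 _; rewrite ge_min lexx.
Qed.

Lemma grid_floor (N : nat) (x : R) : (0 < N)%N -> 0 <= x ->
  exists i : nat, i%:R / N%:R <= x < i%:R / N%:R + N%:R^-1.
Proof.
move=> N0 x0; have N0' : 0 < N%:R :> R by rewrite ltr0n.
exists (Num.truncn (x * N%:R)).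
have := @truncn_itv _ (x * N%:R); rewrite mulr_ge0 ?ler0n // => /(_ isT) /andP[h1 h2].
rewrite ler_pdivrMr // h1 /=.
have -> : forall i : nat, i%:R / N%:R + N%:R^-1 = i.+1%:R / N%:R :> R.
  by move=> i; rewrite -[i.+1]addn1 natrD mulrDl mul1r.
by rewrite ltr_pdivlMr.
Qed.

Lemma exists_inv_lt (e : R) : 0 < e ->
  exists2 N0, (0 < N0)%N & forall N, (N0 <= N)%N -> N%:R^-1 < e.
Proof.
move=> e0; exists (Num.truncn (e^-1)).+1 => // N hN.
have N0 : 0 < N%:R :> R by rewrite ltr0n; lia.
rewrite invf_plt ?posrE //; apply: lt_le_trans (_ : (Num.truncn e^-1).+1%:R <= _).
  by have := @truncn_itv _ e^-1; rewrite invr_ge0 ltW // => /(_ isT) /andP[].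
by rewrite ler_nat.
Qed.

Variables (f1 f2 : R -> R -> R) (sg : R * R -> int).

Definition square_zero (z : R * R) :=
  [/\ 0 <= z.1 <= 1, 0 <= z.2 <= 1, f1 z.1 z.2 = 0 & f2 z.1 z.2 = 0].

Definition regular_field := forall x y, 0 <= x <= 1 -> 0 <= y <= 1 ->
  exists a b c d, [/\ diff2 f1 x y a b, diff2 f2 x y c d &
    f1 x y = 0 -> f2 x y = 0 -> a * d - b * c != 0 /\ sg (x, y) = sgz (a * d - b * c)].

Hypothesis reg : regular_field.

(** At a zero, a second zero nearby would have [g1 = g2 = 0], so each displacement would be at most
    an eighth of their sum, and both vanish. Elsewhere the field has no zero nearby. *)
Lemma zero_isolated x y : 0 <= x <= 1 -> 0 <= y <= 1 ->
  exists2 e : R, 0 < e & forall z, square_zero z -> `|z.1 - x| < e -> `|z.2 - y| < e -> z = (x, y).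
Proof.
move=> x01 y01; have [a [b [c [d [d1 d2 H]]]]] := reg x01 y01.
have shift (u v : R) : u + (v - u) = v by ring.
have [[z1 z2]|nz] := pselect (f1 x y = 0 /\ f2 x y = 0).
  have [Dt _] := H z1 z2; have [e e0 He] := diff2_zero_lin d1 d2 z1 z2 Dt.
  exists e => // -[x' y'] [/= _ _ w1 w2] hx hy.
  have [g1 [g2 []]] := He _ _ (ltW hx) (ltW hy).
  rewrite !shift w1 w2 => e1 e2 k1 k2.
  have g10 : g1 = 0.
    apply/eqP; have : (a * d - b * c) * g1 == 0.
      rewrite (_ : _ * _ = d * (a * g1 + b * g2) - b * (c * g1 + d * g2)); last by ring.
      by rewrite -e1 -e2 !mulr0 subrr.
    by rewrite mulf_eq0 (negbTE Dt).
  have g20 : g2 = 0.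
    apply/eqP; have : (a * d - b * c) * g2 == 0.
      rewrite (_ : _ * _ = a * (c * g1 + d * g2) - c * (a * g1 + b * g2)); last by ring.
      by rewrite -e1 -e2 !mulr0 subrr.
    by rewrite mulf_eq0 (negbTE Dt).
  move: k1 k2; rewrite g10 g20 !sub0r !normrN => k1 k2.
  have X0 := normr_ge0 (x' - x); have Y0 := normr_ge0 (y' - y).
  have /eqP : `|x' - x| = 0 by lra.
  have /eqP : `|y' - y| = 0 by lra.
  by rewrite !normr_eq0 !subr_eq0 => /eqP-> /eqP->.
have [e e0 He] := diff2_near_neq0 d1 d2 nz.
exists e => // -[x' y'] [/= _ _ w1 w2] hx hy.
by have := He _ _ hx hy; rewrite !shift w1 w2 /dot2 /= !mulr0 addr0 ltxx.
Qed.

Lemma finite_zeros : exists zs : seq (R * R), uniq zs /\ forall z, z \in zs <-> square_zero z.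
Proof.
(* Uniform isolation: with one [e], two zeros in a common box of radius [e] coincide. One chosen
   zero per node of a grid finer than [e] then exhausts them. *)
have [||e e0 He] := @uniform_square R (fun x y e => forall z z', square_zero z -> square_zero z' ->
  `|z.1 - x| < e -> `|z.2 - y| < e -> `|z'.1 - x| < e -> `|z'.2 - y| < e -> z = z').
- move=> x y e e' H e'0 ee' z z' zz zz' *.
  by apply: H => //; apply: lt_le_trans ee'.
- move=> x y x01 y01; have [e e0 He] := zero_isolated x01 y01.
  exists (e / 2) => [|x' y' _ _ hx hy z z' zz zz' h1 h2 h3 h4]; first lra.
  have tri (u v w : R) : `|u - v| < e / 2 -> `|v - w| < e / 2 -> `|u - w| < e.
    move=> h h'; rewrite (_ : u - w = (u - v) + (v - w)); last by ring.
    by apply: le_lt_trans (ler_normD _ _) _; lra.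
  rewrite (He z zz (tri _ _ _ h1 hx) (tri _ _ _ h2 hy)).
  by rewrite (He z' zz' (tri _ _ _ h3 hx) (tri _ _ _ h4 hy)).
have [N N0 HN] := exists_inv_lt e0; have {HN} Ne := HN N (leqnn N).
pose P (i j : nat) z := [/\ square_zero z, `|z.1 - i%:R / N%:R| < e & `|z.2 - j%:R / N%:R| < e].
pose pick i j := match pselect (exists z, P i j z) with
  left h => [:: projT1 (cid h)] | right _ => [::] end.
pose zs := [seq z <- flatten [seq pick i j | i <- iota 0 N.+1, j <- iota 0 N.+1] | `[< square_zero z >]].
exists (undup zs); split; first exact: undup_uniq.
move=> z; rewrite mem_undup mem_filter; split; first by case/andP => /asboolP.
move=> zz; apply/andP; split; first exact/asboolP.
have [zx zy _ _] := zz.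
have [i /andP[i1 i2]] := grid_floor N0 (proj1 (andP zx)).
have [j /andP[j1 j2]] := grid_floor N0 (proj1 (andP zy)).
have N0' : 0 < N%:R :> R by rewrite ltr0n.
have bd (k : nat) (u : R) : 0 <= u <= 1 -> k%:R / N%:R <= u -> (k < N.+1)%N.
  move=> /andP[_ u1] ku; have := le_trans ku u1.
  by rewrite ler_pdivrMr // mul1r ler_nat.
have Pz : P i j z.
  by split=> //; rewrite ger0_norm ?subr_ge0 //; lra.
apply/flattenP.
exists (pick i j).
  by apply/allpairsP; exists (i, j); rewrite !mem_iota /= (bd i z.1) ?(bd j z.2).
rewrite /pick; case: pselect => [h|[]]; last by exists z.
case: (cid h) => w [ww w1 w2] /=; rewrite inE; apply/eqP.
have [_ v1 v2] := Pz.
have N1 (k : nat) : (k < N.+1)%N -> 0 <= (k%:R / N%:R : R) <= 1.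
  by move=> kN; rewrite divr_ge0 ?ler0n //= ler_pdivrMr // mul1r ler_nat -ltnS.
exact: (He _ _ (N1 _ (bd _ _ zx i1)) (N1 _ (bd _ _ zy j1)) _ _ zz ww v1 v2 w1 w2).
Qed.

Definition grid (N : nat) (i j : nat) : R * R :=
  (f1 (i%:R / N%:R) (j%:R / N%:R), f2 (i%:R / N%:R) (j%:R / N%:R)).

Definition linear_at (z : R * R) (e : R) := exists a b c d : R,
  [/\ a * d - b * c != 0, sg z = sgz (a * d - b * c) &
   forall X Y, `|X| <= e -> `|Y| <= e -> exists g1 g2 : R,
    [/\ f1 (z.1 + X) (z.2 + Y) = a * g1 + b * g2,
      f2 (z.1 + X) (z.2 + Y) = c * g1 + d * g2,
      `|g1 - X| <= (`|X| + `|Y|) / 8 & `|g2 - Y| <= (`|X| + `|Y|) / 8]].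

(** Every side of the block is at distance between [e / 2] and [e] from [z], so one coordinate of
    the perturbed displacement keeps its sign along it. The field then stays in one half plane, and
    the turning of the side reduces to that between its end corners. *)
Lemma block_sum (N : nat) z e (a b c d : nat) : linear_at z e -> 0 < e -> (0 < N)%N ->
  e / 2 <= z.1 - a%:R / N%:R <= e -> e / 2 <= b%:R / N%:R - z.1 <= e ->
  e / 2 <= z.2 - c%:R / N%:R <= e -> e / 2 <= d%:R / N%:R - z.2 <= e ->
  bdry (grid N) a b c d = 2 * sg z.
Proof.
move=> [p [q [r [s [Dt0 -> lin]]]]] e0 N0 ha hb hc hd.
have N0' : 0 < N%:R :> R by rewrite ltr0n.
have mono (i j : nat) : (i%:R / N%:R <= j%:R / N%:R :> R) = (i <= j)%N.
  by rewrite ler_pM2r ?invr_gt0 // ler_nat.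
have ab : (a <= b)%N by rewrite -mono; lra.
have cd : (c <= d)%N by rewrite -mono; lra.
have G (i j : nat) : exists g : R * R, (a <= i <= b)%N -> (c <= j <= d)%N ->
  [/\ grid N i j = (p * g.1 + q * g.2, r * g.1 + s * g.2),
      `|g.1 - (i%:R / N%:R - z.1)| <= e / 4 & `|g.2 - (j%:R / N%:R - z.2)| <= e / 4].
  have [iab|] := boolP (a <= i <= b)%N; last by exists (0, 0).
  have [jcd|] := boolP (c <= j <= d)%N; last by exists (0, 0).
  move: iab jcd; rewrite -!mono => /andP[i1 i2] /andP[j1 j2].
  have hX : `|i%:R / N%:R - z.1| <= e by rewrite ler_norml; lra.
  have hY : `|j%:R / N%:R - z.2| <= e by rewrite ler_norml; lra.
  have [g1 [g2 [e1 e2 k1 k2]]] := lin _ _ hX hY.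
  exists (g1, g2) => _ _; split=> /=; [|lra|lra].
  by rewrite /grid -e1 -e2; congr (f1 _ _, f2 _ _); ring.
have {G} [g Hg] : exists g : nat -> nat -> R * R, forall i j, (a <= i <= b)%N -> (c <= j <= d)%N ->
  [/\ grid N i j = (p * (g i j).1 + q * (g i j).2, r * (g i j).1 + s * (g i j).2),
      `|(g i j).1 - (i%:R / N%:R - z.1)| <= e / 4 & `|(g i j).2 - (j%:R / N%:R - z.2)| <= e / 4].
  by exists (fun i j => projT1 (cid (G i j))) => i j; case: cid.
have ga j : (c <= j <= d)%N -> (g a j).1 < 0.
  move=> jj; have [|_ + _] := Hg a j _ jj; first by rewrite leqnn ab.
  by rewrite ler_norml; lra.
have gb j : (c <= j <= d)%N -> 0 < (g b j).1.
  move=> jj; have [|_ + _] := Hg b j _ jj; first by rewrite leqnn ab.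
  by rewrite ler_norml; lra.
have gc i : (a <= i <= b)%N -> (g i c).2 < 0.
  move=> ii; have [|_ _] := Hg i c ii; first by rewrite leqnn cd.
  by rewrite ler_norml; lra.
have gd i : (a <= i <= b)%N -> 0 < (g i d).2.
  move=> ii; have [|_ _] := Hg i d ii; first by rewrite leqnn cd.
  by rewrite ler_norml; lra.
set Dt := p * s - q * r in Dt0 *.
have D2 : 0 < Dt * Dt by rewrite -expr2 exprn_even_gt0.
have r1 (v : R * R) : dot2 (Dt * s, - (Dt * q)) (p * v.1 + q * v.2, r * v.1 + s * v.2) = Dt * Dt * v.1.
  by rewrite /dot2 /Dt /=; ring.
have r2 (v : R * R) : dot2 (- (Dt * r), Dt * p) (p * v.1 + q * v.2, r * v.1 + s * v.2) = Dt * Dt * v.2.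
  by rewrite /dot2 /Dt /=; ring.
have r1' (v : R * R) : dot2 (- (Dt * s), Dt * q) (p * v.1 + q * v.2, r * v.1 + s * v.2) = Dt * Dt * - v.1.
  by rewrite /dot2 /Dt /=; ring.
have r2' (v : R * R) : dot2 (Dt * r, - (Dt * p)) (p * v.1 + q * v.2, r * v.1 + s * v.2) = Dt * Dt * - v.2.
  by rewrite /dot2 /Dt /=; ring.
have caa : (a <= a <= b)%N by rewrite leqnn ab.
have cbb : (a <= b <= b)%N by rewrite leqnn ab.
have ccc : (c <= c <= d)%N by rewrite leqnn cd.
have cdd : (c <= d <= d)%N by rewrite leqnn cd.
rewrite /bdry !big_split /= !sumrN /hstep /vstep.
rewrite (@sum_hturn_half _ (grid N ^~ c) (Dt * r, - (Dt * p))) //; last first.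
  by move=> i ii; have [-> _ _] := Hg i c ii ccc; rewrite r2' mulr_gt0 ?oppr_gt0 ?gc.
rewrite (@sum_hturn_half _ (grid N ^~ d) (- (Dt * r), Dt * p)) //; last first.
  by move=> i ii; have [-> _ _] := Hg i d ii cdd; rewrite r2 mulr_gt0 ?gd.
rewrite (@sum_hturn_half _ (grid N b) (Dt * s, - (Dt * q))) //; last first.
  by move=> i ii; have [-> _ _] := Hg b i cbb ii; rewrite r1 mulr_gt0 ?gb.
rewrite (@sum_hturn_half _ (grid N a) (- (Dt * s), Dt * q)) //; last first.
  by move=> i ii; have [-> _ _] := Hg a i caa ii; rewrite r1' mulr_gt0 ?oppr_gt0 ?ga.
rewrite -(@hturn_linear_loop _ p q r s (g a c) (g b c) (g b d) (g a d)) ?ga ?gb ?gc ?gd //.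
have [<- _ _] := Hg a c caa ccc; have [<- _ _] := Hg b c cbb ccc.
have [<- _ _] := Hg a d caa cdd; have [<- _ _] := Hg b d cbb cdd.
by rewrite [LHS]addrA; ring.
Qed.

Theorem bdry_index :
  (forall z, square_zero z -> 0 < z.1 < 1 /\ 0 < z.2 < 1) ->
  exists zs : seq (R * R), [/\ uniq zs, forall z, z \in zs <-> square_zero z &
    exists N0, forall N, (N0 <= N)%N ->
      bdry (grid N) 0 N 0 N = 2 * \sum_(z <- zs) sg z].
Proof.
move=> int; have [zs [uz zsP]] := finite_zeros; exists zs; split=> //.
pose P z e := [/\ e < z.1 < 1 - e, e < z.2 < 1 - e, linear_at z e &
  forall z', z' \in zs -> `|z'.1 - z.1| <= 2 * e -> `|z'.2 - z.2| <= 2 * e -> z' = z].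
have [||e e0 He] := @seq_uniform _ zs P.
- move=> z e e' [h1 h2 [a [b [c [d [h3 h4 h5]]]]] h6] e'0 ee'; split; [lra|lra| |].
    exists a, b, c, d; split=> // X Y hX hY; apply: h5; lra.
  move=> z' z'zs h7 h8; apply: h6 => //; lra.
- move=> z /zsP zz; have [zx zy z1 z2] := zz; have [ix iy] := int z zz.
  have [e1 e10 He1] := zero_isolated zx zy.
  have [a [b [c [d [d1 d2]]]]] := reg zx zy.
  move=> /(_ z1 z2)[Dt sgE]; have [e2 e20 He2] := diff2_zero_lin d1 d2 z1 z2 Dt.
  pose m := Num.min (Num.min (Num.min z.1 (1 - z.1)) (Num.min z.2 (1 - z.2))) (Num.min e1 e2).
  have [m1 m2 m3 m4 [m5 m6 m0]] : [/\ m <= z.1, m <= 1 - z.1, m <= z.2, m <= 1 - z.2 &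
     [/\ m <= e1, m <= e2 & 0 < m]].
    by rewrite /m !ge_min !lt_min !lexx ?orbT; split=> //; split=> //; lra.
  (* A third leaves strict room to the sides and keeps the separation distance [2 * e] below
     [e1]. *)
  exists (m / 3); first lra; split; [lra|lra| |].
    exists a, b, c, d; split=> //; first by rewrite -sgE; case: (z).
    by move=> X Y hX hY; apply: He2; lra.
  move=> z' /zsP z'z h1 h2; rewrite [z]surjective_pairing; apply: He1 => //; lra.
(* Uniform alternative: a point is close to a zero, or all field values within [r] of it lie in one
   half plane. *)
have [||e' e'0 He'] := @uniform_square R (fun x y r =>
  (exists2 z, z \in zs & `|x - z.1| <= e / 2 /\ `|y - z.2| <= e / 2) \/
  (exists l, forall x' y', `|x' - x| < r -> `|y' - y| < r -> 0 < dot2 l (f1 x' y', f2 x' y'))).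
- move=> x y r r' [h|[l Hl]] r'0 rr'; [by left|right; exists l => x' y' hx hy].
  by apply: Hl; apply: lt_le_trans rr'.
- move=> x y x01 y01; have [a [b [c [d [d1 d2 _]]]]] := reg x01 y01.
  have [[z1 z2]|nz] := pselect (f1 x y = 0 /\ f2 x y = 0).
    exists (e / 2) => [|x' y' _ _ hx hy]; first lra.
    by left; exists (x, y); [apply/zsP; split | split; apply: ltW].
  have [r r0 Hr] := diff2_near_neq0 d1 d2 nz.
  exists (r / 2) => [|x' y' _ _ hx hy]; first lra.
  right; exists (f1 x y, f2 x y) => x'' y'' hx' hy'.
  have tri (u v w : R) : `|u - v| < r / 2 -> `|v - w| < r / 2 -> `|u - w| < r.
    move=> h h'; rewrite (_ : u - w = (u - v) + (v - w)); last by ring.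
    by apply: le_lt_trans (ler_normD _ _) _; lra.
  have := Hr (x'' - x) (y'' - y) (tri _ _ _ hx' hx) (tri _ _ _ hy' hy).
  by rewrite !(_ : forall u v : R, u + (v - u) = v) // => u v; ring.
(* Mesh below [e'] puts the four corners of a cell in one half plane; mesh below [e / 2] keeps a
   square of half-width [e / 2], rounded outward to the grid, within distance [e] of its zero. *)
have m0 : 0 < Num.min e' (e / 2) by rewrite lt_min e'0; lra.
have [N0 N00 HN0] := exists_inv_lt m0; exists N0 => N NN.
have := HN0 N NN; rewrite lt_min => /andP[Ne' Ne].
have Np : (0 < N)%N by lia.
have Np' : 0 < N%:R :> R by rewrite ltr0n.
have Nv : 0 < N%:R^-1 :> R by rewrite invr_gt0.
have mono (i j : nat) : (i%:R / N%:R < j%:R / N%:R :> R) = (i < j)%N.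
  by rewrite ltr_pM2r ?invr_gt0 // ltr_nat.
have lem (i j : nat) : (i%:R / N%:R <= j%:R / N%:R :> R) = (i <= j)%N.
  by rewrite ler_pM2r ?invr_gt0 // ler_nat.
have S1 (i : nat) : i.+1%:R / N%:R = i%:R / N%:R + N%:R^-1 :> R.
  by rewrite -[i.+1]addn1 natrD mulrDl mul1r.
have BLK z : exists q : nat * nat * (nat * nat), z \in zs ->
  let: ((a, b), (c, d)) := q in
  [/\ z.1 - e / 2 - N%:R^-1 < a%:R / N%:R <= z.1 - e / 2,
      z.1 + e / 2 < b%:R / N%:R <= z.1 + e / 2 + N%:R^-1,
      z.2 - e / 2 - N%:R^-1 < c%:R / N%:R <= z.2 - e / 2,
      z.2 + e / 2 < d%:R / N%:R <= z.2 + e / 2 + N%:R^-1 &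
      (a <= b)%N && (b <= N)%N && (c <= d)%N && (d <= N)%N].
  have [zz|] := boolP (z \in zs); last by exists ((0, 0), (0, 0))%N.
  have [h1 h2 _ _] := He z zz.
  have [|a Ha] := @grid_floor N (z.1 - e / 2) Np; first lra.
  have [|b Hb] := @grid_floor N (z.1 + e / 2) Np; first lra.
  have [|c Hc] := @grid_floor N (z.2 - e / 2) Np; first lra.
  have [|d Hd] := @grid_floor N (z.2 + e / 2) Np; first lra.
  have N1 : N%:R / N%:R = 1 :> R by rewrite divff // gt_eqF.
  exists ((a, b.+1), (c, d.+1)) => _; rewrite !S1; split; [lra..|].
  have ab : (a < b.+1)%N by rewrite -mono S1; lra.
  have cd : (c < d.+1)%N by rewrite -mono S1; lra.
  have bN : (b < N)%N by rewrite -mono N1; lra.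
  have dN : (d < N)%N by rewrite -mono N1; lra.
  by rewrite bN dN (ltnW ab) (ltnW cd).
pose q z := projT1 (cid (BLK z)).
pose inb z i j := ((q z).1.1 <= i < (q z).1.2)%N && ((q z).2.1 <= j < (q z).2.2)%N.
have qP z : z \in zs -> let: ((a, b), (c, d)) := q z in
  [/\ z.1 - e / 2 - N%:R^-1 < a%:R / N%:R <= z.1 - e / 2,
      z.1 + e / 2 < b%:R / N%:R <= z.1 + e / 2 + N%:R^-1,
      z.2 - e / 2 - N%:R^-1 < c%:R / N%:R <= z.2 - e / 2,
      z.2 + e / 2 < d%:R / N%:R <= z.2 + e / 2 + N%:R^-1 &
      (a <= b)%N && (b <= N)%N && (c <= d)%N && (d <= N)%N].
  by rewrite /q; case: cid.
rewrite -sum_cell // big_distrr /=.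
(* A cell lies in at most one block, since the centres of two blocks sharing a cell are within
   [2 * e]; a cell in no block has no turning. *)
transitivity (\sum_(0 <= i < N) \sum_(0 <= j < N) \sum_(z <- zs)
  (if inb z i j then cell (grid N) i j else 0)).
  apply: eq_big_nat => i /= iN; apply: eq_big_nat => j /= jN.
  have [[z zz zin]|nin] := pselect (exists2 z, z \in zs & inb z i j).
    rewrite (bigD1_seq z) //= zin big1_seq ?addr0 // => w /andP[wz ws].
    case: ifP => // win; case/negP: wz; apply/eqP.
    have [_ _ _ sep] := He z zz; apply: sep => //.
    - move: zin win; rewrite /inb; have := qP z zz; have := qP w ws.
      case: (q z) (q w) => [[a b] [c d]] [[a' b'] [c' d']] /= [w1 w2 _ _ _] [z1 z2 _ _ _].
      move=> /andP[/andP[k1 k2] _] /andP[/andP[k3 k4] _].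
      move: k1 k2 k3 k4; rewrite -!mono -!lem => k1 k2 k3 k4.
      by rewrite ler_norml; lra.
    - move: zin win; rewrite /inb; have := qP z zz; have := qP w ws.
      case: (q z) (q w) => [[a b] [c d]] [[a' b'] [c' d']] /= [_ _ w1 w2 _] [_ _ z1 z2 _].
      move=> /andP[_ /andP[k1 k2]] /andP[_ /andP[k3 k4]].
      move: k1 k2 k3 k4; rewrite -!mono -!lem => k1 k2 k3 k4.
      by rewrite ler_norml; lra.
  rewrite big1_seq => [|w /= ws]; last by case: ifP => // win; case: nin; exists w.
  have in01 (k : nat) : (k < N)%N -> 0 <= (k%:R / N%:R : R) <= 1.
    by move=> kN; rewrite divr_ge0 ?ler0n //= ler_pdivrMr // mul1r ler_nat ltnW.
  have [[z zz [h1 h2]]|[l Hl]] := He' _ _ (in01 i iN) (in01 j jN).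
    case: nin; exists z => //; rewrite /inb; have := qP z zz.
    case: (q z) => [[a b] [c d]] /= [z1 z2 z3 z4 _].
    move: h1 h2; rewrite !ler_norml => h1 h2.
    by rewrite -(lem a i) -(lem c j) -(mono i b) -(mono j d); lra.
  have k0 (t : R) : `|t - t| < e' by rewrite subrr normr0.
  have k1 (t : R) : `|t + N%:R^-1 - t| < e'.
    by rewrite (_ : _ - t = N%:R^-1) ?gtr0_norm //; ring.
  by apply: (@cell_half _ _ l); apply: Hl; rewrite ?S1.
rewrite (eq_big_nat _ _ (F2 := fun i => \sum_(z <- zs) \sum_(0 <= j < N)
   (if inb z i j then cell (grid N) i j else 0))); last by move=> i _; rewrite exchange_big.
rewrite exchange_big /=; apply: eq_big_seq => z zz.
have := qP z zz; rewrite /inb; case: (q z) => [[a b] [c d]] /= [h1 h2 h3 h4].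
move=> /andP[/andP[/andP[ab bN] cd] dN].
have [_ _ lz _] := He z zz.
rewrite -(@block_sum N z e a b c d) //; [|lra..].
rewrite -sum_cell // -(@sum_nat_if _ a b N) //; apply: eq_big_nat => i _.
case: ifP => _ /=; last by rewrite big1.
exact: sum_nat_if.
Qed.

End Planar.

(** * Vectors and bilinear forms in dimension three *)

Notation o1 := (lift ord0 ord0 : 'I_3).
Notation o2 := (lift ord0 (lift ord0 ord0) : 'I_3).

Lemma sum3 (K : nmodType) (F : 'I_3 -> K) : \sum_i F i = F ord0 + F o1 + F o2.
Proof. by rewrite !big_ord_recl big_ord0 addr0 addrA. Qed.

Lemma ord3P (P : 'I_3 -> Prop) : P ord0 -> P o1 -> P o2 -> forall i, P i.
Proof.
move=> h0 h1 h2 [[|[|[|//]]] hi].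
- by rewrite (_ : Ordinal hi = ord0) //; apply: val_inj.
- by rewrite (_ : Ordinal hi = o1) //; apply: val_inj.
- by rewrite (_ : Ordinal hi = o2) //; apply: val_inj.
Qed.

Section Vec.
Variable R : fieldType.
Implicit Types x y p q u v w : 'I_3 -> R.

Definition dot3 x y : R := \sum_i x i * y i.
Definition det3 x y z : R :=
  x ord0 * (y o1 * z o2 - y o2 * z o1) - x o1 * (y ord0 * z o2 - y o2 * z ord0)
  + x o2 * (y ord0 * z o1 - y o1 * z ord0).
Definition bil (M : 'I_3 -> 'I_3 -> R) p q : R := \sum_i \sum_j p i * M i j * q j.
(** Determinant of the matrix of [bil M] on the pair [p, q]. No symmetry is assumed, because the
    Jacobian at a base point is skew. *)
Definition minor2 (M : 'I_3 -> 'I_3 -> R) p q : R :=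
  bil M p p * bil M q q - bil M p q * bil M q p.

Lemma dot3_eq0 w p q x : det3 p q x != 0 -> dot3 w p = 0 -> dot3 w q = 0 -> dot3 w x = 0 ->
  forall i, w i = 0.
Proof.
rewrite /dot3 !sum3 => D hp hq hx; pose D' := det3 p q x.
have key i : D' * w i = 0 -> w i = 0.
  by move/eqP; rewrite mulf_eq0 (negbTE D) => /eqP.
apply: ord3P; apply: key.
- have -> : D' * w ord0 =
   (w ord0 * p ord0 + w o1 * p o1 + w o2 * p o2) * (q o1 * x o2 - q o2 * x o1)
   - (w ord0 * q ord0 + w o1 * q o1 + w o2 * q o2) * (p o1 * x o2 - p o2 * x o1)
   + (w ord0 * x ord0 + w o1 * x o1 + w o2 * x o2) * (p o1 * q o2 - p o2 * q o1).
    by rewrite /D' /det3; ring.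
  by rewrite hp hq hx; ring.
- have -> : D' * w o1 =
   - (w ord0 * p ord0 + w o1 * p o1 + w o2 * p o2) * (q ord0 * x o2 - q o2 * x ord0)
   + (w ord0 * q ord0 + w o1 * q o1 + w o2 * q o2) * (p ord0 * x o2 - p o2 * x ord0)
   - (w ord0 * x ord0 + w o1 * x o1 + w o2 * x o2) * (p ord0 * q o2 - p o2 * q ord0).
    by rewrite /D' /det3; ring.
  by rewrite hp hq hx; ring.
- have -> : D' * w o2 =
   (w ord0 * p ord0 + w o1 * p o1 + w o2 * p o2) * (q ord0 * x o1 - q o1 * x ord0)
   - (w ord0 * q ord0 + w o1 * q o1 + w o2 * q o2) * (p ord0 * x o1 - p o1 * x ord0)
   + (w ord0 * x ord0 + w o1 * x o1 + w o2 * x o2) * (p ord0 * q o1 - p o1 * q ord0).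
    by rewrite /D' /det3; ring.
  by rewrite hp hq hx; ring.
Qed.

Lemma cramer3 u v w x i :
  det3 u v w * x i = det3 x v w * u i + det3 u x w * v i + det3 u v x * w i.
Proof. by move: i; apply: ord3P; rewrite /det3; ring. Qed.

Lemma bil_comb M p u v x (a b c : R) y : (forall i, \sum_j M i j * x j = 0) ->
  (forall i, y i = a * u i + b * v i + c * x i) ->
  bil M p y = a * bil M p u + b * bil M p v.
Proof.
move=> ker yE.
have k0 : \sum_i p i * (\sum_j M i j * x j) = 0 by rewrite big1 // => i _; rewrite ker mulr0.
rewrite /bil !sum3 !yE; move: k0; rewrite !sum3 => k0.
by rewrite -[RHS]addr0 -(mulr0 c) -k0; ring.
Qed.

End Vec.

Section PolyDiff.
Variable R : realType.

(** Chain rule: the polynomials satisfying it contain the constants and the variables and are closed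
    under sums and products. *)
Lemma diff2_meval (X : 'I_3 -> R -> R -> R) (Xx Xy : 'I_3 -> R) x y :
  (forall i, diff2 (X i) x y (Xx i) (Xy i)) ->
  forall P : {mpoly R[3]}, diff2 (fun x y => P.@[fun i => X i x y]) x y
    (\sum_j P^`M(j).@[fun i => X i x y] * Xx j) (\sum_j P^`M(j).@[fun i => X i x y] * Xy j).
Proof.
move=> dX; set v := fun i => X i x y.
pose good (P : {mpoly R[3]}) := diff2 (fun x y => P.@[fun i => X i x y]) x y
    (\sum_j P^`M(j).@[v] * Xx j) (\sum_j P^`M(j).@[v] * Xy j).
have gC c : good c%:MP.
  rewrite /good; under eq_fun do under eq_fun do rewrite mevalC.
  by apply: (diff2_eq (diff2_cst c x y)); rewrite big1 // => j _; rewrite mderivC meval0 mul0r.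
have gD P Q : good P -> good Q -> good (P + Q).
  move=> gP gQ; rewrite /good; under eq_fun do under eq_fun do rewrite mevalD.
  apply: (diff2_eq (diff2D gP gQ)); rewrite -big_split /=; apply: eq_bigr => j _;
  by rewrite mderivD mevalD mulrDl.
have gM P Q : good P -> good Q -> good (P * Q).
  move=> gP gQ; rewrite /good; under eq_fun do under eq_fun do rewrite mevalM.
  apply: (diff2_eq (diff2M gP gQ)); rewrite big_distrl big_distrr -big_split /=;
  by apply: eq_bigr => j _; rewrite mderivM mevalD !mevalM /v; ring.
have gX i : good 'X_i.
  rewrite /good; under eq_fun do under eq_fun do rewrite mevalXU.
  have E (W : 'I_3 -> R) : W i = \sum_j ('X_i : {mpoly R[3]})^`M(j).@[v] * W j.
    rewrite (bigD1 i) //= big1 => [|j ji]; rewrite mderivX mevalZ mnm1E.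
      by rewrite eqxx mul1r addr0 (_ : (U_(i) - U_(i))%MM = 0%MM) ?mpolyX0 ?meval1 ?mul1r //;
         apply/mnmP => k; rewrite mnmBE mnm0E subnn.
    by rewrite eq_sym (negbTE ji) !mul0r.
  by apply: (diff2_eq (dX i)); rewrite -E.
have g1 : good 1 by have := gC 1; rewrite mpolyC1.
have gXn i k : good ('X_i ^+ k).
  by elim: k => [|k IH]; [rewrite expr0 | rewrite exprS; apply: gM].
elim/mpolyind => [|c m P _ _ gP]; first by have := gC 0; rewrite mpolyC0.
rewrite -/(good _); apply: gD => //; rewrite -mul_mpolyC; apply: (gM _ _) => //.
rewrite mpolyXE_id; apply: (big_ind good g1 gM) => i _.
exact: gXn.
Qed.

End PolyDiff.

Lemma det3_nonzero (R : fieldType) (p q x : 'I_3 -> R) : det3 p q x != 0 -> nonzero_pt x.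
Proof.
move=> D; apply: contrapT => /forallNP nz.
have z i : x i = 0 by apply/eqP; apply/negP/negP/negP => h; apply: (nz i); apply/negP.
by case/eqP: D; rewrite /det3 !z; ring.
Qed.

(** * Linear forms avoiding finitely many points *)

Section Generic.
Variable R : realType.
Implicit Types x : 'I_3 -> R.

(** The forms [(1, t, t^2)] run on a conic: any three of them are independent, and at most two
    vanish at a given nonzero vector. *)
Definition quad_eval x (t : R) := x ord0 + t * x o1 + t ^+ 2 * x o2.

Lemma qeval_large x : nonzero_pt x -> exists N0, forall n, (N0 <= n)%N -> quad_eval x n%:R != 0.
Proof.
move=> nz; apply: contrapT => /forallNP H.
have G N0 : exists2 n, (N0 <= n)%N & quad_eval x n%:R = 0.
  apply: contrapT => K; apply: (H N0) => n hn; apply/eqP => E; apply: K; by exists n.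
have [a _ ha] := G 0%N; have [b hab hb] := G a.+1; have [c hbc hc] := G b.+1.
have ab : a%:R + 1 <= b%:R :> R by rewrite natr1 ler_nat.
have bc : b%:R + 1 <= c%:R :> R by rewrite natr1 ler_nat.
move: ha hb hc ab bc; rewrite /quad_eval; set A := a%:R; set B := b%:R; set C := c%:R.
move=> ha hb hc ab bc.
have z2 : x o2 = 0.
  (* Second divided difference at the three roots, which isolates the leading coefficient. *)
  have /eqP : (B - A) * (C - B) * (C - A) * x o2 = 0.
    have -> : (B - A) * (C - B) * (C - A) * x o2 =
     (x ord0 + A * x o1 + A ^+ 2 * x o2) * (C - B)
     - (x ord0 + B * x o1 + B ^+ 2 * x o2) * (C - A)
     + (x ord0 + C * x o1 + C ^+ 2 * x o2) * (B - A) by ring.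
    by rewrite ha hb hc; ring.
  by rewrite !mulf_eq0 => /orP[/orP[/orP[]|]|/eqP //] /eqP h; exfalso; lra.
move: ha hb; rewrite z2 !mulr0 !addr0 => ha hb.
have z1 : x o1 = 0.
  have /eqP : (B - A) * x o1 = 0.
    have -> : (B - A) * x o1 = (x ord0 + B * x o1) - (x ord0 + A * x o1) by ring.
    by rewrite ha hb subrr.
  by rewrite mulf_eq0 => /orP[/eqP h|/eqP //]; exfalso; lra.
move: ha; rewrite z1 mulr0 addr0 => z0.
case: nz => i; apply/negP; rewrite negbK; move: i.
by apply: ord3P; rewrite ?z0 ?z1 ?z2.
Qed.

Lemma qeval_large_seq (T : eqType) (s : seq T) (pt : T -> 'I_3 -> R) :
  (forall z, nonzero_pt (pt z)) ->
  exists N0, forall n z, (N0 <= n)%N -> z \in s -> quad_eval (pt z) n%:R != 0.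
Proof.
move=> nz; elim: s => [|z s [N IH]]; first by exists 0%N.
have [N' H] := qeval_large (nz z).
exists (maxn N N') => n w; rewrite geq_max inE => /andP[h1 h2] /orP[/eqP->|ws]; first exact: H.
exact: IH.
Qed.

End Generic.

(** * Zeros of a tangent field on the projective plane *)

Section FieldZeros.
Variables (R : realType) (V : 'I_3 -> {mpoly R[3]}) (m : nat) (sgn : ('I_3 -> R) -> int).
Implicit Types x y p q : 'I_3 -> R.

Definition vf_zero x := forall i, (V i).@[x] = 0.
Definition jac x (i j : 'I_3) : R := (V i)^`M(j).@[x].

Hypothesis tang : forall x, dot3 (fun i => (V i).@[x]) x = 0.
Hypothesis hom : forall (l : R) x i, (V i).@[fun j => l * x j] = l ^+ m * (V i).@[x].
Hypothesis ndeg : forall x p q, vf_zero x -> det3 p q x != 0 ->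
  minor2 (jac x) p q != 0 /\ sgz (minor2 (jac x) p q) = sgn x.

Lemma zero_of_dots x p q : det3 p q x != 0 ->
  dot3 (fun i => (V i).@[x]) p = 0 -> dot3 (fun i => (V i).@[x]) q = 0 -> vf_zero x.
Proof. by move=> D hp hq i; apply: (dot3_eq0 D hp hq (tang x) i). Qed.

(** At a zero of the field the derivative of [W] is multiplied by zero, so the motion of the frame
    contributes nothing to the Jacobian. *)
Lemma diff2_dot (X W : 'I_3 -> R -> R -> R) (Xx Xy Wx Wy : 'I_3 -> R) s t :
  (forall i, diff2 (X i) s t (Xx i) (Xy i)) ->
  (forall i, diff2 (W i) s t (Wx i) (Wy i)) ->
  exists a b, diff2 (fun s t => dot3 (fun i => (V i).@[fun j => X j s t]) (fun i => W i s t)) s t a b /\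
    (vf_zero (fun j => X j s t) ->
      a = bil (jac (fun j => X j s t)) (fun i => W i s t) Xx /\
      b = bil (jac (fun j => X j s t)) (fun i => W i s t) Xy).
Proof.
move=> dX dW; do 2!eexists; split.
  by apply: diff2_sum => i; apply: diff2M; [apply: diff2_meval dX _ | apply: dW].
move=> z; split; apply: eq_bigr => i _; rewrite z mul0r addr0 big_distrl;
  by apply: eq_bigr => j _; rewrite /jac /=; ring.
Qed.

Section Face.
Variables w0 w1 w2 : 'I_3 -> R.
Definition face_pt (z : R * R) : 'I_3 -> R := fun i => w0 i + z.1 * w1 i + z.2 * w2 i.

Lemma det3_face z : det3 w1 w2 (face_pt z) = det3 w1 w2 w0.
Proof. by rewrite /det3 /face_pt; ring. Qed.

(** In an affine chart the constant frame [w1, w2] is complementary to every point, so nondegeneracy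
    makes the two components a regular planar field. *)
Lemma face_finite : det3 w1 w2 w0 != 0 -> exists zs : seq (R * R),
  forall z, 0 <= z.1 <= 1 -> 0 <= z.2 <= 1 -> vf_zero (face_pt z) -> z \in zs.
Proof.
move=> D.
pose f w s t := dot3 (fun i => (V i).@[fun j => face_pt (s, t) j]) w.
have dX s t i : diff2 (fun s t => face_pt (s, t) i) s t (w1 i) (w2 i).
  rewrite /face_pt /=.
  apply: (diff2_eq (diff2D (diff2D (diff2_cst (w0 i) s t)
    (diff2M (diff2_fst s t) (diff2_cst (w1 i) s t)))
    (diff2M (diff2_snd s t) (diff2_cst (w2 i) s t)))); ring.
have dC (w : 'I_3 -> R) s t i : diff2 (fun _ _ => w i : R) s t 0 0 by apply: diff2_cst.
have [|zs [_ zsP]] := @finite_zeros R (f w1) (f w2) (fun z => sgn (face_pt z)).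
  move=> s t _ _.
  have [a [b [d1 Z1]]] := diff2_dot (Wx := fun=> 0) (Wy := fun=> 0) (dX s t) (dC w1 s t).
  have [c [d [d2 Z2]]] := diff2_dot (Wx := fun=> 0) (Wy := fun=> 0) (dX s t) (dC w2 s t).
  exists a, b, c, d; split=> // z1 z2.
  have Dz : det3 w1 w2 (face_pt (s, t)) != 0 by rewrite det3_face.
  have zz := zero_of_dots Dz z1 z2.
  have [-> ->] := Z1 zz; have [-> ->] := Z2 zz.
  by have [h <-] := ndeg zz Dz.
exists zs => z h1 h2 zz; apply/zsP; split=> //; rewrite /f /dot3 big1 // => i _;
  by have /= -> := zz i; rewrite mul0r.
Qed.

End Face.

Lemma vf_zeroZ (l : R) x : vf_zero x -> vf_zero (fun i => l * x i).
Proof. by move=> z i; rewrite hom z mulr0. Qed.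

(** Dividing by a coordinate of largest absolute value moves any point to one of three faces of the
    cube [-1, 1]^3. Each face carries finitely many zeros, so all large [n] avoid them. *)
Lemma generic_forms : exists N0, forall n x, (N0 <= n)%N -> nonzero_pt x -> vf_zero x ->
  quad_eval x n%:R != 0.
Proof.
(* With [w0] and [w1] the unit square parametrises the face where coordinate [k] equals 1. *)
pose e (k : 'I_3) (i : 'I_3) : R := (i == k)%:R.
pose w0 (k l r : 'I_3) i := e k i - e l i - e r i.
pose w1 (k : 'I_3) i := 2 * e k i.
have Df k l r : (k, l, r) \in [:: (ord0, o1, o2); (o1, ord0, o2); (o2, ord0, o1)] ->
  det3 (w1 l) (w1 r) (w0 k l r) != 0.
  rewrite !inE => /or3P[] /eqP[-> -> ->]; rewrite /det3 /w1 /w0 /e /=;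
  by apply/eqP; lra.
have F k l r : (k, l, r) \in [:: (ord0, o1, o2); (o1, ord0, o2); (o2, ord0, o1)] ->
  exists N0, forall n z, (N0 <= n)%N -> 0 <= z.1 <= 1 -> 0 <= z.2 <= 1 ->
    vf_zero (face_pt (w0 k l r) (w1 l) (w1 r) z) ->
    quad_eval (face_pt (w0 k l r) (w1 l) (w1 r) z) n%:R != 0.
  move=> klr; have D := Df _ _ _ klr; have [zs zsP] := face_finite D.
  have [|N H] := @qeval_large_seq R _ zs (face_pt (w0 k l r) (w1 l) (w1 r)).
    by move=> z; apply: (@det3_nonzero _ (w1 l) (w1 r)); rewrite det3_face; exact: D.
  by exists N => n z hn h1 h2 zz; apply: H => //; apply: zsP.
have [N0 H0] := F ord0 o1 o2 isT; have [N1 H1] := F o1 ord0 o2 isT.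
have [N2 H2] := F o2 ord0 o1 isT.
exists (N0 + N1 + N2)%N => n x hn nz zx.
have red k l r : (k, l, r) \in [:: (ord0, o1, o2); (o1, ord0, o2); (o2, ord0, o1)] ->
  `|x l| <= `|x k| -> `|x r| <= `|x k| ->
  (forall z, 0 <= z.1 <= 1 -> 0 <= z.2 <= 1 ->
    vf_zero (face_pt (w0 k l r) (w1 l) (w1 r) z) ->
    quad_eval (face_pt (w0 k l r) (w1 l) (w1 r) z) n%:R != 0) -> quad_eval x n%:R != 0.
  move=> klr hl hr H.
  have xk : x k != 0.
    apply/negP => /eqP k0; move: hl hr; rewrite k0 normr0 !normr_le0 => /eqP l0 /eqP r0.
    case: nz => i /negP; apply; apply/eqP; move: i.
    by move: klr k0 l0 r0; rewrite !inE => /or3P[] /eqP[-> -> ->] ? ? ?; apply: ord3P.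
  pose z := ((x l / x k + 1) / 2, (x r / x k + 1) / 2).
  have bd (u : R) : `|u| <= `|x k| -> 0 <= (u / x k + 1) / 2 <= 1.
    move=> hu; have : `|u / x k| <= 1 by rewrite normrM normfV ler_pdivrMr ?normr_gt0 // mul1r.
    by rewrite ler_norml; lra.
  have E : face_pt (w0 k l r) (w1 l) (w1 r) z = fun i => (x k)^-1 * x i.
    apply: funext => i; move: i klr xk; rewrite /face_pt /z /w0 /w1 /e /=.
    by apply: ord3P; rewrite !inE => /or3P[] /eqP[-> -> ->] /= xk; field.
  have := H z (bd _ hl) (bd _ hr); rewrite E => /(_ (vf_zeroZ _ zx)).
  apply: contraNN => /eqP h; rewrite /quad_eval.
  rewrite (_ : _ + _ = (x k)^-1 * quad_eval x n%:R); last by rewrite /quad_eval; ring.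
  by rewrite h mulr0.
have [h01|h01] := lerP `|x o1| `|x ord0|; have [h02|h02] := lerP `|x o2| `|x ord0|;
  have [h12|h12] := lerP `|x o2| `|x o1|.
all: first
 [ apply: (red ord0 o1 o2 isT); [lra|lra|by move=> z; apply: H0; lia]
 | apply: (red o1 ord0 o2 isT); [lra|lra|by move=> z; apply: H1; lia]
 | apply: (red o2 ord0 o1 isT); [lra|lra|by move=> z; apply: H2; lia]].
Qed.

(** By Cramer's rule these determinants are the coordinates of [x] in the basis, up to a common
    factor: the zeros avoid the three coordinate lines. *)
Definition coord_avoid (u1 u2 u3 : 'I_3 -> R) := forall x, nonzero_pt x -> vf_zero x ->
  [/\ det3 x u2 u3 != 0, det3 u1 x u3 != 0 & det3 u1 u2 x != 0].

Lemma generic_basis : exists u1 u2 u3 : 'I_3 -> R,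
  det3 u1 u2 u3 != 0 /\ coord_avoid u1 u2 u3.
Proof.
have [N H] := generic_forms.
pose a : R := N%:R; pose b : R := N.+1%:R; pose c : R := N.+2%:R.
have ab : b = a + 1 by rewrite /a /b natr1.
have ac : c = a + 2 by rewrite /a /c -addn2 natrD.
(* the dual basis of the forms (1, t, t^2), up to scaling *)
pose cr (s t : R) (i : 'I_3) : R :=
  if i == ord0 then s * t ^+ 2 - s ^+ 2 * t else if i == o1 then s ^+ 2 - t ^+ 2 else t - s.
(* The factor 2 is the Vandermonde determinant of three consecutive integers. *)
have D3 x : [/\ det3 x (cr c a) (cr a b) = 2 * quad_eval x a,
   det3 (cr b c) x (cr a b) = 2 * quad_eval x b & det3 (cr b c) (cr c a) x = 2 * quad_eval x c].
  by rewrite ab ac /det3 /cr /quad_eval /=; split; ring.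
exists (cr b c), (cr c a), (cr a b); split.
  have [-> _ _] := D3 (cr b c); rewrite ab ac /quad_eval /cr /=; apply/eqP; nra.
move=> x nz zx; have [-> -> ->] := D3 x; rewrite !mulf_eq0 !negb_or pnatr_eq0 /=.
by split; apply: H => //; lia.
Qed.

End FieldZeros.

(** * Poincare-Hopf on the projective plane *)

Section Quarters.
Variables (R : realType) (V : 'I_3 -> {mpoly R[3]}) (m : nat) (sgn : ('I_3 -> R) -> int).
Implicit Types x y p q : 'I_3 -> R.
Hypothesis tang : forall x, dot3 (fun i => (V i).@[x]) x = 0.
Hypothesis odd_m : odd m.
Hypothesis hom : forall (l : R) x i, (V i).@[fun j => l * x j] = l ^+ m * (V i).@[x].
Hypothesis ker : forall x, vf_zero V x -> forall i, \sum_j jac V x i j * x j = 0.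
Hypothesis ndeg : forall x p q, vf_zero V x -> det3 p q x != 0 ->
  minor2 (jac V x) p q != 0 /\ sgz (minor2 (jac V x) p q) = sgn x.

Variables u1 u2 u3 : 'I_3 -> R.
Hypothesis Du : det3 u1 u2 u3 != 0.
Hypothesis avoid : coord_avoid V u1 u2 u3.

Definition cone_pt (t c1 c2 : R) : 'I_3 -> R :=
  fun i => t * (c1 * u1 i + c2 * u2 i) + (1 - t) * u3 i.
Definition radial_vec (c1 c2 : R) : 'I_3 -> R := fun i => c1 * u1 i + c2 * u2 i - u3 i.
(** A quarter turn of the direction [(c1, c2)] replaces the [s]-derivative of the point, which jumps
    at the corners of the diamond and vanishes at the apex. The radial vector is the
    [t]-derivative. *)
Definition angular_vec (c1 c2 : R) : 'I_3 -> R := fun i => c1 * u2 i - c2 * u1 i.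
Definition radial_comp t c1 c2 : R := dot3 (fun i => (V i).@[cone_pt t c1 c2]) (radial_vec c1 c2).
Definition angular_comp t c1 c2 : R := dot3 (fun i => (V i).@[cone_pt t c1 c2]) (angular_vec c1 c2).
(* (cx, cy) runs along the segment from a to its quarter turn (- a.2, a.1). *)
Definition cx (a : R * R) (s : R) : R := (1 - s) * a.1 - s * a.2.
Definition cy (a : R * R) (s : R) : R := (1 - s) * a.2 + s * a.1.
Definition quarter_pt (a z : R * R) := cone_pt z.1 (cx a z.2) (cy a z.2).
Definition quarter_rad a t s : R := radial_comp t (cx a s) (cy a s).
Definition quarter_ang a t s : R := angular_comp t (cx a s) (cy a s).

Lemma det3_frame t c1 c2 :
  det3 (radial_vec c1 c2) (angular_vec c1 c2) (cone_pt t c1 c2) = (c1 ^+ 2 + c2 ^+ 2) * det3 u1 u2 u3.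
Proof. by rewrite /det3 /radial_vec /angular_vec /cone_pt; ring. Qed.

Lemma cone_pt_coords t c1 c2 : [/\ det3 (cone_pt t c1 c2) u2 u3 = t * c1 * det3 u1 u2 u3,
  det3 u1 (cone_pt t c1 c2) u3 = t * c2 * det3 u1 u2 u3 &
  det3 u1 u2 (cone_pt t c1 c2) = (1 - t) * det3 u1 u2 u3].
Proof. by rewrite /det3 /cone_pt; split; ring. Qed.

Definition dirs : seq (R * R) := [:: (1, 0); (0, 1); (-1, 0); (0, -1)].

Lemma dirsP a : a \in dirs -> a.1 * a.2 = 0 /\ a.1 ^+ 2 + a.2 ^+ 2 = 1.
Proof. by rewrite !inE => /or4P[] /eqP-> /=; split; ring. Qed.

Lemma quarter_norm a s : a \in dirs -> 0 < cx a s ^+ 2 + cy a s ^+ 2.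
Proof.
move=> /dirsP[_ a1].
have -> : cx a s ^+ 2 + cy a s ^+ 2 = ((1 - s) ^+ 2 + s ^+ 2) * (a.1 ^+ 2 + a.2 ^+ 2).
  by rewrite /cx /cy; ring.
by rewrite a1 mulr1; have := sqr_ge0 (2 * s - 1); nra.
Qed.

Lemma quarter_det a z : a \in dirs ->
  det3 (radial_vec (cx a z.2) (cy a z.2)) (angular_vec (cx a z.2) (cy a z.2)) (quarter_pt a z) != 0.
Proof. by move=> ad; rewrite det3_frame mulf_neq0 // gt_eqF // quarter_norm. Qed.

(** On a side of the square some coordinate in [u1, u2, u3] vanishes, which [avoid] excludes; for
    the sides in [s] this holds because [a] is parallel to an axis. *)
Lemma quarter_interior a z : a \in dirs -> 0 <= z.1 <= 1 -> 0 <= z.2 <= 1 ->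
  vf_zero V (quarter_pt a z) -> 0 < z.1 < 1 /\ 0 < z.2 < 1.
Proof.
move=> ad h1 h2 zz; have [] := avoid (det3_nonzero (quarter_det z ad)) zz.
have [-> -> ->] := cone_pt_coords z.1 (cx a z.2) (cy a z.2).
rewrite !mulf_eq0 !negb_or -!andbA => /and3P[t0 c0 _] /and3P[_ d0 _] /andP[t1 _].
have [aa _] := dirsP ad.
have n0 : z.2 != 0.
  apply/eqP => s0; move: c0 d0; rewrite /cx /cy s0 !mul0r !subr0 !mul1r addr0 => c0 d0.
  by have := mulf_neq0 c0 d0; rewrite aa eqxx.
have n1 : z.2 != 1.
  apply/eqP => s0; move: c0 d0; rewrite /cx /cy s0 subrr !mul0r sub0r add0r !mul1r oppr_eq0 => c0 d0.
  by have := mulf_neq0 d0 c0; rewrite aa eqxx.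
rewrite !lt_neqAle [0 == _]eq_sym [0 == z.2]eq_sym t0 n0 n1.
by rewrite (_ : z.1 != 1) ?andbT /=; [split; case/andP: h1; case/andP: h2 => *; apply/andP; split | rewrite eq_sym -subr_eq0].
Qed.

Lemma quarter_zeroP a z : a \in dirs ->
  quarter_rad a z.1 z.2 = 0 /\ quarter_ang a z.1 z.2 = 0 <-> vf_zero V (quarter_pt a z).
Proof.
move=> ad; split.
  by case=> h1 h2; apply: (zero_of_dots tang (quarter_det z ad) h1 h2).
by move=> zz; split; rewrite /quarter_rad /quarter_ang /radial_comp /angular_comp /dot3 big1 // => i _;
  have := zz i; rewrite /quarter_pt => ->; rewrite mul0r.
Qed.

(** The planar Jacobian is a positive multiple of the minor on the frame, so its sign is [sgn] in
    all four squares alike. *)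
Lemma quarter_regular a : a \in dirs ->
  regular_field (quarter_rad a) (quarter_ang a) (fun z => sgn (quarter_pt a z)).
Proof.
move=> ad t s t01 s01; have [_ a1] := dirsP ad.
pose d1 := - a.1 - a.2; pose d2 := a.1 - a.2.
pose Xs i := t * (d1 * u1 i + d2 * u2 i).
have dX i : diff2 (fun t s => cone_pt t (cx a s) (cy a s) i) t s (radial_vec (cx a s) (cy a s) i) (Xs i).
  by rewrite /cone_pt /cx /cy /radial_vec /Xs /d1 /d2; diff2_poly.
have dP i : diff2 (fun t s => radial_vec (cx a s) (cy a s) i) t s 0 (d1 * u1 i + d2 * u2 i).
  by rewrite /cx /cy /radial_vec /d1 /d2; diff2_poly.
have dQ i : diff2 (fun t s => angular_vec (cx a s) (cy a s) i) t s 0 (d1 * u2 i - d2 * u1 i).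
  by rewrite /cx /cy /angular_vec /d1 /d2; diff2_poly.
have [A [B [D1 Z1]]] := diff2_dot V (Wx := fun=> 0) dX dP.
have [C [D [D2 Z2]]] := diff2_dot V (Wx := fun=> 0) dX dQ.
exists A, B, C, D; split=> // z1 z2.
have zz : vf_zero V (quarter_pt a (t, s)) by apply/(quarter_zeroP (t, s) ad).
have [/andP[/= t0 _] _] := quarter_interior (z := (t, s)) ad t01 s01 zz.
have [AE BE] := Z1 zz; have [CE DE] := Z2 zz.
set P := radial_vec (cx a s) (cy a s); set Q := angular_vec (cx a s) (cy a s).
pose n := cx a s ^+ 2 + cy a s ^+ 2.
have n0 : 0 < n by apply: quarter_norm.
pose al := t * (d1 * cx a s + d2 * cy a s) / n.
(* Modulo the kernel of the Jacobian matrix, the s-derivative of the point is a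
   combination of the frame with positive angular coefficient t / n. *)
have XsE i : Xs i = al * (1 - t) * P i + t / n * Q i + al * quarter_pt a (t, s) i.
  have a1' : (a.1 ^+ 2 + a.2 ^+ 2) * (t / n) = t / n by rewrite a1 mul1r.
  rewrite -a1' /Xs /al /P /Q /radial_vec /angular_vec /quarter_pt /cone_pt /=.
  have nn : n != 0 by rewrite gt_eqF.
  apply: (mulfI nn); move: nn; rewrite /n /cx /cy /d1 /d2 => nn.
  by field.
have bilE p := bil_comb p (ker zz) XsE.
have DtE : A * D - B * C = t / n * minor2 (jac V (quarter_pt a (t, s))) P Q.
  by rewrite AE BE CE DE !bilE /minor2; ring.
have [m0 sE] := ndeg zz (quarter_det (t, s) ad).
have tn : 0 < t / n by rewrite divr_gt0.
rewrite DtE; split; last by rewrite sgzM (gtr0_sgz tn) mul1r sE.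
by rewrite mulf_neq0 // gt_eqF.
Qed.

Lemma quarter_index a : a \in dirs ->
  exists zs : seq (R * R), [/\ uniq zs,
    forall z, z \in zs <-> [/\ 0 <= z.1 <= 1, 0 <= z.2 <= 1 & vf_zero V (quarter_pt a z)] &
    exists N0, forall N, (N0 <= N)%N ->
      bdry (grid (quarter_rad a) (quarter_ang a) N) 0 N 0 N = 2 * \sum_(z <- zs) sgn (quarter_pt a z)].
Proof.
move=> ad; have [|zs [uz zsP HN]] := bdry_index (quarter_regular ad).
  by move=> z [h1 h2 h3 h4]; apply: (quarter_interior ad) => //; apply/quarter_zeroP.
exists zs; split=> // z; rewrite zsP; split.
  by move=> [h1 h2 h3 h4]; split=> //; apply/quarter_zeroP.
by move=> [h1 h2 /(quarter_zeroP _ ad)[h3 h4]].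
Qed.

Lemma grid_seam a b N i : (0 < N)%N -> b.1 = - a.2 -> b.2 = a.1 ->
  grid (quarter_rad a) (quarter_ang a) N i N = grid (quarter_rad b) (quarter_ang b) N i 0.
Proof.
move=> N0 b1 b2; rewrite /grid divff ?pnatr_eq0 -?lt0n // mul0r /quarter_rad /quarter_ang.
by rewrite /cx /cy b1 b2 !subrr !subr0 !mul0r !mul1r !sub0r !add0r addr0 subr0.
Qed.

(** The point and, by odd degree, the field change sign; so does the angular vector, hence the
    angular component is kept. At [t = 1] tangency reduces the radial component to minus the
    component along [u3], a vector that stays fixed, so it flips. *)
Lemma grid_mirror a b N j : (0 < N)%N -> b.1 = - a.1 -> b.2 = - a.2 ->
  grid (quarter_rad b) (quarter_ang b) N N j =
    (- (grid (quarter_rad a) (quarter_ang a) N N j).1, (grid (quarter_rad a) (quarter_ang a) N N j).2).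
Proof.
move=> N0 b1 b2; rewrite /grid divff ?pnatr_eq0 -?lt0n // /quarter_rad /quarter_ang /=.
set s := j%:R / _.
have -> : cx b s = - cx a s by rewrite /cx b1 b2; ring.
have -> : cy b s = - cy a s by rewrite /cy b1 b2; ring.
set c := cx a s; set d := cy a s.
have XE : cone_pt 1 (- c) (- d) = fun i => (-1) * cone_pt 1 c d i.
  by apply: funext => i; rewrite /cone_pt; ring.
have T := tang (cone_pt 1 c d); move: T.
rewrite /radial_comp /angular_comp /dot3 XE !sum3 !hom -signr_odd odd_m expr1 /radial_vec /angular_vec /cone_pt => T.
set v0 := (V ord0).@[_] in T *; set v1 := (V o1).@[_] in T *; set v2 := (V o2).@[_] in T *.
congr (_, _); last by ring.
by rewrite -[RHS]addr0 -[X in _ = _ + X](mulr0 2) -T; ring.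
Qed.

Lemma apex_neq0 :
  (dot3 (fun i => (V i).@[u3]) u1 != 0) || (dot3 (fun i => (V i).@[u3]) u2 != 0).
Proof.
rewrite -negb_and; apply/negP => /andP[/eqP W1 /eqP W2].
have z3 : vf_zero V u3 by apply: (zero_of_dots tang Du W1 W2).
by have [] := avoid (det3_nonzero Du) z3; rewrite (_ : det3 u3 u2 u3 = 0) ?eqxx // /det3; ring.
Qed.

(** At the apex the point is [u3] throughout: the field is constant and only the frame turns, by a
    quarter. *)
Lemma sum_vstep_apex a N : (0 < N)%N -> a \in dirs ->
  let w1 := dot3 (fun i => (V i).@[u3]) u1 in let w2 := dot3 (fun i => (V i).@[u3]) u2 in
  \sum_(0 <= j < N) vstep (grid (quarter_rad a) (quarter_ang a) N) 0 j =
  hturn (a.1 * w1 + a.2 * w2, a.1 * w2 - a.2 * w1) (- a.2 * w1 + a.1 * w2, - a.2 * w2 - a.1 * w1).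
Proof.
move=> N0 ad w1 w2; have [_ a1] := dirsP ad.
have N0' : 0 < N%:R :> R by rewrite ltr0n.
have X0 c d : cone_pt 0 c d = u3 by apply: funext => i; rewrite /cone_pt; ring.
have T := tang u3.
have FE c d : radial_comp 0 c d = c * w1 + d * w2 /\ angular_comp 0 c d = c * w2 - d * w1.
  split; rewrite /radial_comp /angular_comp X0 /radial_vec /angular_vec /w1 /w2; move: T; rewrite /dot3 !sum3 => T; last by ring.
  by rewrite -[RHS]subr0 -T; ring.
have gE j : grid (quarter_rad a) (quarter_ang a) N 0 j = (cx a (j%:R / N%:R) * w1 + cy a (j%:R / N%:R) * w2,
    cx a (j%:R / N%:R) * w2 - cy a (j%:R / N%:R) * w1).
  by rewrite /grid mul0r /quarter_rad /quarter_ang; have [-> ->] := FE (cx a (j%:R / N%:R)) (cy a (j%:R / N%:R)).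
have W : 0 < w1 ^+ 2 + w2 ^+ 2.
  rewrite lt_neqAle eq_sym paddr_eq0 ?sqr_ge0 // !sqrf_eq0 addr_ge0 ?sqr_ge0 // andbT.
  by rewrite negb_and; apply: apex_neq0.
(* The covector is the sum of the first and last vectors. These are orthogonal of equal length and
   the path runs on the segment between them, so the covector is constant along it. *)
rewrite /vstep (@sum_hturn_half _ (grid (quarter_rad a) (quarter_ang a) N 0)
  ((a.1 - a.2) * w1 + (a.1 + a.2) * w2, (a.1 - a.2) * w2 - (a.1 + a.2) * w1)) //; last first.
  move=> j _; rewrite gE /dot2 /=; set s := j%:R / _.
  rewrite [ltRHS](_ : _ = (a.1 ^+ 2 + a.2 ^+ 2) * (w1 ^+ 2 + w2 ^+ 2)).
    by rewrite a1 mul1r.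
  by rewrite /cx /cy; ring.
rewrite !gE mul0r divff ?gt_eqF // /cx /cy.
by congr hturn; congr (_, _); ring.
Qed.


Lemma sum_bdry_quarters N : (0 < N)%N ->
  \sum_(a <- dirs) bdry (grid (quarter_rad a) (quarter_ang a) N) 0 N 0 N = 2.
Proof.
move=> N0; pose g a := grid (quarter_rad a) (quarter_ang a) N.
have seam a b : b.1 = - a.2 -> b.2 = a.1 ->
  \sum_(0 <= i < N) hstep (g a) i N = \sum_(0 <= i < N) hstep (g b) i 0.
  by move=> h1 h2; apply: eq_bigr => i _; rewrite /hstep /g !(grid_seam _ N0 h1 h2).
have mir a b : b.1 = - a.1 -> b.2 = - a.2 ->
  \sum_(0 <= j < N) vstep (g b) N j = - \sum_(0 <= j < N) vstep (g a) N j.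
  move=> h1 h2; rewrite -sumrN; apply: eq_bigr => j _.
  by rewrite /vstep /g !(grid_mirror _ N0 h1 h2) hturn_mirror.
pose w1 := dot3 (fun i => (V i).@[u3]) u1; pose w2 := dot3 (fun i => (V i).@[u3]) u2.
have ap a A B : a \in dirs -> (a.1 * w1 + a.2 * w2, a.1 * w2 - a.2 * w1) = A ->
  (- a.2 * w1 + a.1 * w2, - a.2 * w2 - a.1 * w1) = B ->
  \sum_(0 <= j < N) vstep (g a) 0 j = hturn A B.
  by move=> ad <- <-; exact: sum_vstep_apex.
have ap0 : \sum_(0 <= j < N) vstep (g (1, 0)) 0 j = hturn (w1, w2) (w2, - w1).
  by apply: ap; rewrite ?inE ?eqxx ?orbT //=; congr (_, _); ring.
have ap1 : \sum_(0 <= j < N) vstep (g (0, 1)) 0 j = hturn (w2, - w1) (- w1, - w2).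
  by apply: ap; rewrite ?inE ?eqxx ?orbT //=; congr (_, _); ring.
have ap2 : \sum_(0 <= j < N) vstep (g (-1, 0)) 0 j = hturn (- w1, - w2) (- w2, w1).
  by apply: ap; rewrite ?inE ?eqxx ?orbT //=; congr (_, _); ring.
have ap3 : \sum_(0 <= j < N) vstep (g (0, -1)) 0 j = hturn (- w2, w1) (w1, w2).
  by apply: ap; rewrite ?inE ?eqxx ?orbT //=; congr (_, _); ring.
have bE a : bdry (g a) 0 N 0 N = \sum_(0 <= i < N) hstep (g a) i 0
   - \sum_(0 <= i < N) hstep (g a) i N + (\sum_(0 <= j < N) vstep (g a) N j
   - \sum_(0 <= j < N) vstep (g a) 0 j).
  by rewrite /bdry !big_split /= !sumrN.
(* Only the apex sides survive, with a minus sign because [t = 0] is the left side of each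
   square. *)
transitivity (- (hturn (w1, w2) (w2, - w1) + hturn (w2, - w1) (- w1, - w2)
  + hturn (- w1, - w2) (- w2, w1) + hturn (- w2, w1) (w1, w2))).
  rewrite /dirs !big_cons big_nil !bE ap0 ap1 ap2 ap3.
  rewrite (seam (1, 0) (0, 1)) /= ?oppr0 // (seam (0, 1) (-1, 0)) //=.
  rewrite (seam (-1, 0) (0, -1)) /= ?oppr0 // (seam (0, -1) (1, 0)) /= ?opprK //.
  rewrite (mir (1, 0) (-1, 0)) /= ?oppr0 // (mir (0, 1) (0, -1)) /= ?oppr0 //.
  by ring.
by rewrite (hturn_rot_loop apex_neq0) opprK.
Qed.

(** In the coordinates of [u1, u2, u3] the squares form the upper half of the octahedron
    [|y1| + |y2| + |y3| = 1]. The third coordinate fixes the sign of the scalar, the norm its size,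
    and the signs of the first two coordinates name the square. *)
Lemma quarter_pt_proj_inj a b z w : a \in dirs -> b \in dirs ->
  0 < z.1 < 1 /\ 0 < z.2 < 1 -> 0 < w.1 < 1 /\ 0 < w.2 < 1 ->
  proj_eq (quarter_pt a z) (quarter_pt b w) -> (a, z) = (b, w).
Proof.
case: z w => [t s] [t' s'] /= ad bd [/andP[t0 t1] /andP[s0 s1]] [/andP[t0' t1'] /andP[s0' s1']] [l l0 E].
have [c1 c2 c3] := cone_pt_coords t (cx a s) (cy a s).
have [c1' c2' c3'] := cone_pt_coords t' (cx b s') (cy b s').
have Ef : quarter_pt b (t', s') = fun i => l * quarter_pt a (t, s) i by apply: funext.
move: c1' c2' c3'; rewrite -/(quarter_pt b (t', s')) Ef.
have -> : det3 (fun i => l * quarter_pt a (t, s) i) u2 u3 = l * det3 (quarter_pt a (t, s)) u2 u3.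
  by rewrite /det3; ring.
have -> : det3 u1 (fun i => l * quarter_pt a (t, s) i) u3 = l * det3 u1 (quarter_pt a (t, s)) u3.
  by rewrite /det3; ring.
have -> : det3 u1 u2 (fun i => l * quarter_pt a (t, s) i) = l * det3 u1 u2 (quarter_pt a (t, s)).
  by rewrite /det3; ring.
rewrite /quarter_pt /= c1 c2 c3 !mulrA => /(mulIf Du) e1 /(mulIf Du) e2 /(mulIf Du) e3.
have lp : 0 < l by have := l0; rewrite -(pmulr_lgt0 _ (_ : 0 < 1 - t)); lra.
have p1 : 0 < t * s by rewrite mulr_gt0.
have p2 : 0 < t * (1 - s) by rewrite mulr_gt0 // subr_gt0.
have p3 : 0 < t' * s' by rewrite mulr_gt0.
have p4 : 0 < t' * (1 - s') by rewrite mulr_gt0 // subr_gt0.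
have p5 := mulr_gt0 lp p1; have p6 := mulr_gt0 lp p2.
have fin : l = 1 -> t * s = t' * s' -> a = b -> ((a, (t, s)) = (b, (t', s'))).
  move=> l1 ts ->; have tt : t = t' by move: e3; rewrite l1 mul1r; lra.
  by move: ts; rewrite tt => /mulfI -> //; rewrite gt_eqF.
move: ad bd e1 e2; rewrite /cx /cy !inE => /or4P[] /eqP aE /or4P[] /eqP bE;
  rewrite aE bE /= => e1 e2.
all: try (by exfalso; lra).
all: have l1 : l = 1 by lra.
all: by rewrite -{1}aE -bE; apply: fin; rewrite ?aE ?bE //; rewrite l1 in e1 e2; lra.
Qed.

Lemma quarter_pt_cover x : nonzero_pt x -> vf_zero V x ->
  exists a z, [/\ a \in dirs, 0 <= z.1 <= 1, 0 <= z.2 <= 1 & proj_eq (quarter_pt a z) x].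
Proof.
move=> nz zx; have [y1 y2 y3] := avoid nz zx; pose D := det3 u1 u2 u3; have D0 : D != 0 := Du.
pose T := `|det3 x u2 u3| + `|det3 u1 x u3| + `|det3 u1 u2 x|.
have T0 : 0 < T by rewrite !addr_gt0 ?normr_gt0.
(* The scalar that moves [x] to the upper half octahedron: it makes the third coordinate positive
   and the sum of absolute values 1. *)
pose l := Num.sg (det3 u1 u2 x) * D / T.
have s0 : Num.sg (det3 u1 u2 x) != 0 by rewrite sgr_eq0.
have T1 : T^-1 != 0 by rewrite invr_eq0 gt_eqF.
have l0 : l != 0 by rewrite mulf_neq0 // mulf_neq0.
pose Y1 := Num.sg (det3 u1 u2 x) * det3 x u2 u3 / T.
pose Y2 := Num.sg (det3 u1 u2 x) * det3 u1 x u3 / T.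
pose Y3 := Num.sg (det3 u1 u2 x) * det3 u1 u2 x / T.
have Y30 : 0 < Y3 by rewrite /Y3 divr_gt0 // -normrEsg normr_gt0.
have xE i : l * x i = Y1 * u1 i + Y2 * u2 i + Y3 * u3 i.
  have := cramer3 u1 u2 u3 x i; rewrite -/D => C.
  by rewrite /l mulrAC -[_ * D * x i]mulrA C /Y1 /Y2 /Y3; ring.
have nY : `|Y1| + `|Y2| + Y3 = 1.
  have -> : Y3 = `|Y3| by rewrite gtr0_norm.
  rewrite /Y1 /Y2 /Y3 !normrM !normr_sg y3 /= !mul1r -!mulrDl normfV [`|T|]gtr0_norm //.
  by rewrite divff // gt_eqF.
have Y10 : Y1 != 0 by rewrite mulf_neq0 // mulf_neq0.
have Y20 : Y2 != 0 by rewrite mulf_neq0 // mulf_neq0.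
have fin a t s : a \in dirs -> 0 <= t <= 1 -> 0 <= s <= 1 -> t * cx a s = Y1 -> t * cy a s = Y2 ->
  1 - t = Y3 -> exists a z, [/\ a \in dirs, 0 <= z.1 <= 1, 0 <= z.2 <= 1 & proj_eq (quarter_pt a z) x].
  move=> ad ht hs e1 e2 e3; exists a, (t, s); split=> //; exists l^-1; rewrite ?invr_eq0 //.
  move=> i; apply: (mulfI l0); rewrite mulrA divff // mul1r xE -e1 -e2 -e3 /quarter_pt /cone_pt /=.
  ring.
pose t := 1 - Y3.
have tE : 1 - t = Y3 by rewrite /t; ring.
have sb (y : R) : 0 < y -> y < t -> exists2 s, t * s = y & 0 <= s <= 1.
  move=> h1 h2; exists (y / t); first by rewrite mulrC divfK // gt_eqF //; lra.
  by rewrite divr_ge0 ?ler_pdivrMr ?mul1r /=; lra.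
have [h1|h1|h1] := ltrgtP Y1 0; last by rewrite h1 eqxx in Y10.
all: have [h2|h2|h2] := ltrgtP Y2 0; try by rewrite h2 eqxx in Y20.
all: move: nY; rewrite ?(ltr0_norm h1) ?(gtr0_norm h1) ?(ltr0_norm h2) ?(gtr0_norm h2) => nY.
- have [||s ts s01] := sb (- Y2); [lra|rewrite /t; lra|].
  by apply: (fin (-1, 0) t s) => //; rewrite ?inE ?eqxx ?orbT // /cx /cy /t /= in ts *; lra.
- have [||s ts s01] := sb (- Y1); [lra|rewrite /t; lra|].
  by apply: (fin (0, 1) t s) => //; rewrite ?inE ?eqxx ?orbT // /cx /cy /t /= in ts *; lra.
- have [||s ts s01] := sb Y1; [lra|rewrite /t; lra|].
  by apply: (fin (0, -1) t s) => //; rewrite ?inE ?eqxx ?orbT // /cx /cy /t /= in ts *; lra.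
- have [||s ts s01] := sb Y2; [lra|rewrite /t; lra|].
  by apply: (fin (1, 0) t s) => //; rewrite ?inE ?eqxx ?orbT // /cx /cy /t /= in ts *; lra.
Qed.

Lemma index_sum_basis : exists n (P : 'I_n -> 'I_3 -> R),
  [/\ forall i, nonzero_pt (P i) /\ vf_zero V (P i),
      forall i j, proj_eq (P i) (P j) -> i = j,
      forall x, nonzero_pt x -> vf_zero V x -> exists i, proj_eq (P i) x &
      \sum_i sgn (P i) = 1].
Proof.
have Q a : exists zs : seq (R * R), a \in dirs -> [/\ uniq zs,
    forall z, z \in zs <-> [/\ 0 <= z.1 <= 1, 0 <= z.2 <= 1 & vf_zero V (quarter_pt a z)] &
    exists N0, forall N, (N0 <= N)%N ->
      bdry (grid (quarter_rad a) (quarter_ang a) N) 0 N 0 N = 2 * \sum_(z <- zs) sgn (quarter_pt a z)].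
  have [ad|] := boolP (a \in dirs); last by exists [::].
  by have [zs H] := quarter_index ad; exists zs.
pose zs a := projT1 (cid (Q a)).
have zsP a : a \in dirs -> [/\ uniq (zs a),
    forall z, z \in zs a <-> [/\ 0 <= z.1 <= 1, 0 <= z.2 <= 1 & vf_zero V (quarter_pt a z)] &
    exists N0, forall N, (N0 <= N)%N ->
      bdry (grid (quarter_rad a) (quarter_ang a) N) 0 N 0 N = 2 * \sum_(z <- zs a) sgn (quarter_pt a z)].
  by rewrite /zs; case: cid.
have [N [N0 HN]] : exists N, (0 < N)%N /\ forall a, a \in dirs ->
  bdry (grid (quarter_rad a) (quarter_ang a) N) 0 N 0 N = 2 * \sum_(z <- zs a) sgn (quarter_pt a z).
  suff H (s : seq (R * R)) : {subset s <= dirs} -> exists N0, forall N, (N0 <= N)%N ->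
     forall a, a \in s ->
     bdry (grid (quarter_rad a) (quarter_ang a) N) 0 N 0 N = 2 * \sum_(z <- zs a) sgn (quarter_pt a z).
    by have [|N0 H0] := H dirs; [|exists N0.+1; split=> // a; apply: H0].
  elim: s => [|a s IH] sub; first by exists 0%N.
  have [|M HM] := IH; first by move=> b bs; apply: sub; rewrite inE bs orbT.
  have [|_ _ [M' HM']] := zsP a; first by apply: sub; rewrite inE eqxx.
  exists (maxn M M') => N; rewrite geq_max => /andP[h1 h2] b; rewrite inE => /orP[/eqP->|bs].
    exact: HM'.
  exact: HM.
pose Ps := [seq (a, z) | a <- dirs, z <- zs a].
pose pt (e : (R * R) * (R * R)) := quarter_pt e.1 e.2.
have PsP e : e \in Ps -> e.1 \in dirs /\ e.2 \in zs e.1.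
  by case/allpairsPdep => a [z [ad zz ->]].
have udirs : uniq dirs.
  by rewrite /= !inE !xpair_eqE; do !(apply/andP; split) => //; apply/negP;
    do ?[case/orP]; case/andP => /eqP h1 /eqP h2; lra.
have uPs : uniq Ps.
  apply: allpairs_uniq_dep => //; first by move=> a ad; have [] := zsP a ad.
  by move=> [a z] [b w] _ _ [-> ->].
pose e0 : (R * R) * (R * R) := ((0, 0), (0, 0)).
exists (size Ps), (fun i => pt (nth e0 Ps i)); split.
- move=> i; have [h1 h2] := PsP _ (mem_nth e0 (ltn_ord i)).
  have [_ zP _] := zsP _ h1; have [_ _ zz] := (zP _).1 h2.
  by split=> //; apply: (det3_nonzero (quarter_det _ h1)).
- move=> i j E; have [h1 h2] := PsP _ (mem_nth e0 (ltn_ord i)).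
  have [h3 h4] := PsP _ (mem_nth e0 (ltn_ord j)).
  have [_ zP _] := zsP _ h1; have [b1 b2 zz] := (zP _).1 h2.
  have [_ zP' _] := zsP _ h3; have [b3 b4 zz'] := (zP' _).1 h4.
  have I1 := quarter_interior h1 b1 b2 zz; have I2 := quarter_interior h3 b3 b4 zz'.
  have := quarter_pt_proj_inj h1 h3 I1 I2 E; rewrite -!surjective_pairing => /eqP.
  by rewrite nth_uniq // => /eqP /val_inj.
- move=> x nz zx; have [a [z [ad b1 b2 [l l0 E]]]] := quarter_pt_cover nz zx.
  have zz : vf_zero V (quarter_pt a z).
    have -> : quarter_pt a z = fun i => l^-1 * x i.
      by apply: funext => i; rewrite E mulrA mulVf // mul1r.
    exact: (vf_zeroZ hom).
  have [_ zP _] := zsP _ ad.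
  have inP : (a, z) \in Ps.
    by apply/allpairsPdep; exists a, z; split=> //; apply/zP.
  have iP : (index (a, z) Ps < size Ps)%N by rewrite index_mem.
  by exists (Ordinal iP); rewrite /= nth_index //; exists l.
have S2 := sum_bdry_quarters N0.
have : 2 * \sum_(i < size Ps) sgn (pt (nth e0 Ps i)) = 2.
  rewrite -[RHS]S2 -(big_mkord xpredT (fun i => sgn (pt (nth e0 Ps i)))) -(big_nth e0 xpredT (fun e => sgn (pt e))).
  rewrite big_allpairs_dep big_distrr /=.
  by apply: eq_big_seq => a ad; rewrite HN.
by move: (\sum_(i < _) _) => S; lia.
Qed.

End Quarters.

(** The value 1 is the Euler characteristic of the projective plane. Odd degree makes the field
    change sign with [x], as a lift of a tangent field on the quotient by the antipodal map must. *)
Theorem index_sum (R : realType) (V : 'I_3 -> {mpoly R[3]}) (m : nat)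
    (sgn : ('I_3 -> R) -> int) :
  (forall x, dot3 (fun i => (V i).@[x]) x = 0) -> odd m ->
  (forall (l : R) x i, (V i).@[fun j => l * x j] = l ^+ m * (V i).@[x]) ->
  (forall x, vf_zero V x -> forall i, \sum_j jac V x i j * x j = 0) ->
  (forall x p q, vf_zero V x -> det3 p q x != 0 ->
    minor2 (jac V x) p q != 0 /\ sgz (minor2 (jac V x) p q) = sgn x) ->
  exists n (P : 'I_n -> 'I_3 -> R),
  [/\ forall i, nonzero_pt (P i) /\ vf_zero V (P i),
      forall i j, proj_eq (P i) (P j) -> i = j,
      forall x, nonzero_pt x -> vf_zero V x -> exists i, proj_eq (P i) x &
      \sum_i sgn (P i) = 1].
Proof.
move=> tang odd_m hom ker ndeg.
have [u1 [u2 [u3 [Du avoid]]]] := generic_basis tang hom ndeg.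
exact: (index_sum_basis tang odd_m hom ker ndeg Du avoid).
Qed.

(** * Homogeneous polynomials and quadratic forms *)

Section Homog.
Variables (n : nat) (K : comNzRingType).
Implicit Types (P : {mpoly K[n]}) (v : 'I_n -> K).

Lemma mnm1_le (m : 'X_{1..n}) i : (0 < m i)%N -> (U_(i) <= m)%MM.
Proof. by move=> mi; apply/mnm_lepP => j; rewrite mnm1E; case: eqP => // <-. Qed.

Lemma dhomog_mderiv d P i : P \is d.-homog -> P^`M(i) \is d.-1.-homog.
Proof.
move=> /dhomogP hP; rewrite /mderiv big_seq; apply: rpred_sum => m mP.
case: (posnP (m i)) => [->|mi]; first by rewrite mul0r scale0r rpred0.
apply: rpredZ; rewrite dhomogX -(hP m mP) -{2}(submK (mnm1_le mi)) /=.
by rewrite mdegD mdeg1 addn1.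
Qed.

Lemma dhomog_scale d P (l : K) v : P \is d.-homog ->
  P.@[fun i => l * v i] = l ^+ d * P.@[v].
Proof.
move=> /dhomogP hP; rewrite !mevalE big_distrr /=; apply: eq_big_seq => m mP.
under eq_bigr do rewrite exprMn.
by rewrite big_split /= prodrXr -mdegE (hP m mP : mdeg m = d); ring.
Qed.

Lemma dhomog_euler d P v : P \is d.-homog ->
  \sum_i v i * P^`M(i).@[v] = d%:R * P.@[v].
Proof.
move=> /dhomogP hP.
transitivity (\sum_(m <- msupp P) P@_m * \sum_i (m i)%:R * ('X_[m] : {mpoly K[n]}).@[v]).
  under [RHS]eq_bigr do rewrite big_distrr /=.
  rewrite exchange_big /=; apply: eq_bigr => i _.
  rewrite /mderiv raddf_sum big_distrr /=; apply: eq_bigr => m _.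
  rewrite mevalZ; case: (posnP (m i)) => [->|mi]; first by rewrite !(mul0r, mulr0).
  have -> : ('X_[m] : {mpoly K[n]}).@[v] = ('X_[m - U_(i)] : {mpoly K[n]}).@[v] * v i.
    by rewrite -[X in _ = _ * X](mevalXU v i) -mevalM -mpolyXD submK // mnm1_le.
  by ring.
rewrite mevalE big_distrr /=; apply: eq_big_seq => m mP.
by rewrite -big_distrl /= -natr_sum -mdegE (hP m mP : mdeg m = d) mevalX; ring.
Qed.

End Homog.

Section MapEval.
Variables (n : nat) (K L : comNzRingType) (f : {rmorphism K -> L}).

Lemma meval_map_mpoly (P : {mpoly K[n]}) v :
  (map_mpoly f P).@[fun i => f (v i)] = f P.@[v].
Proof.
have -> : map_mpoly f P = \sum_(m <- msupp P) f P@_m *: 'X_[m].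
  rewrite {1}(mpolyE P) raddf_sum; apply: eq_bigr => m _.
  by rewrite /= map_mpolyZ map_mpolyX.
rewrite raddf_sum mevalE rmorph_sum /=; apply: eq_bigr => m _.
rewrite mevalZ mevalX rmorphM rmorph_prod /=.
by congr (_ * _); apply: eq_bigr => i _; rewrite rmorphXn.
Qed.

Lemma mderiv_map_mpoly (P : {mpoly K[n]}) i :
  (map_mpoly f P)^`M(i) = map_mpoly f P^`M(i).
Proof.
by apply/mpolyP => m; rewrite mcoeff_map_mpoly !mcoeff_mderiv mcoeff_map_mpoly raddfMn.
Qed.

Lemma meval_map_fixed (g : {rmorphism L -> L}) (P : {mpoly K[n]}) v :
  (forall x, g (f x) = f x) ->
  (map_mpoly f P).@[fun i => g (v i)] = g (map_mpoly f P).@[v].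
Proof.
move=> gf; rewrite !mevalE rmorph_sum /=; apply: eq_bigr => m _.
rewrite rmorphM rmorph_prod mcoeff_map_mpoly /= gf.
by congr (_ * _); apply: eq_bigr => i _; rewrite rmorphXn.
Qed.

End MapEval.

Section SymForm.
Variable R : realFieldType.
Implicit Types (S : 'I_3 -> 'I_3 -> R) (p q x v w : 'I_3 -> R).

Definition indefinite S := exists v w, bil S v v < 0 /\ 0 < bil S w w.
Definition semidefinite S := (forall v, 0 <= bil S v v) \/ (forall v, bil S v v <= 0).

Lemma bil_sym S p q : (forall i j, S i j = S j i) -> bil S p q = bil S q p.
Proof. by move=> sym; rewrite /bil !sum3 (sym o1 ord0) (sym o2 ord0) (sym o2 o1); ring. Qed.

Lemma bil_comb_sq S p q (a b : R) : (forall i j, S i j = S j i) ->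
  bil S (fun i => a * p i + b * q i) (fun i => a * p i + b * q i)
  = a ^+ 2 * bil S p p + 2 * a * b * bil S p q + b ^+ 2 * bil S q q.
Proof. by move=> sym; rewrite /bil !sum3 (sym o1 ord0) (sym o2 ord0) (sym o2 o1); ring. Qed.

Lemma minor2_lt0_indefinite S p q : (forall i j, S i j = S j i) ->
  minor2 S p q < 0 -> indefinite S.
Proof.
move=> sym; rewrite /minor2 (bil_sym q p sym) => m0.
have Q a b := bil_comb_sq p q a b sym; move: m0 Q.
set A := bil S p p; set B := bil S p q; set C := bil S q q => m0 Q.
have E1 : bil S p p = A by [].
have [A0|A0|A0] := ltrgtP A 0.
(* The second vector is orthogonal to [p] for the form, with value [A * (A * C - B * B)], opposite
   in sign to [A]. *)
- exists p, (fun i => B * p i + (- A) * q i); split=> //.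
  by rewrite Q [ltRHS](_ : _ = A * (A * C - B * B)); [rewrite nmulr_rgt0 | ring].
- exists (fun i => B * p i + (- A) * q i), p; split=> //.
  by rewrite Q [ltLHS](_ : _ = A * (A * C - B * B)); [rewrite pmulr_rlt0 | ring].
have B0 : B != 0 by apply/eqP => B0; move: m0; rewrite A0 B0 !mul0r subrr ltxx.
(* With [A = 0] the form on [a * p + q] is [2 * a * B + C], linear in [a]; the two choices give -1
   and 1. *)
exists (fun i => ((- 1 - C) / (2 * B)) * p i + 1 * q i), (fun i => ((1 - C) / (2 * B)) * p i + 1 * q i).
rewrite !Q A0 !mulr0 !add0r expr1n mul1r !mulr1; split.
  by rewrite [ltLHS](_ : _ = -1); [rewrite oppr_lt0 ltr01 | field].
by rewrite [ltRHS](_ : _ = 1); [rewrite ltr01 | field].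
Qed.

(** Modulo the kernel vector [x] only the span of [p, q] matters, and there completing the square
    shows that [A] times the form is nonnegative. *)
Lemma minor2_gt0_semidefinite S p q x : (forall i j, S i j = S j i) ->
  (forall i, \sum_j S i j * x j = 0) -> det3 p q x != 0 ->
  0 < minor2 S p q -> semidefinite S.
Proof.
move=> sym ker D; rewrite /minor2 (bil_sym q p sym) => m0.
have Q a b := bil_comb_sq p q a b sym; move: m0 Q.
set A := bil S p p; set B := bil S p q; set C := bil S q q => m0 Q.
have red v : exists a b, bil S v v = a ^+ 2 * A + 2 * a * b * B + b ^+ 2 * C.
  pose a := det3 v q x / det3 p q x; pose b := det3 p v x / det3 p q x.
  pose c := det3 p q v / det3 p q x; exists a, b; rewrite -Q.
  have vE i : v i = a * p i + b * q i + c * x i.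
    by apply: (mulfI D); rewrite cramer3 /a /b /c; field.
  have vE' i : v i = 1 * (a * p i + b * q i) + 0 * p i + c * x i by rewrite vE; ring.
  rewrite (bil_comb v ker vE') (bil_sym v _ sym) (bil_comb _ ker vE').
  by rewrite !mul1r !mul0r !addr0.
have A0 : A != 0.
  apply/eqP => A0; move: m0; rewrite A0 mul0r sub0r oppr_gt0 -expr2 => h.
  by have := sqr_ge0 B; lra.
have sq a b : 0 <= A * (a ^+ 2 * A + 2 * a * b * B + b ^+ 2 * C).
  rewrite [leRHS](_ : _ = (a * A + b * B) ^+ 2 + b ^+ 2 * (A * C - B * B)); last by ring.
  by rewrite addr_ge0 ?sqr_ge0 // mulr_ge0 ?sqr_ge0 // ltW.
have [An|Ap|E] := ltrgtP A 0; last by rewrite E eqxx in A0.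
  by right=> v; have [a [b ->]] := red v; rewrite -(nmulr_rge0 _ An).
by left=> v; have [a [b ->]] := red v; rewrite -(pmulr_rge0 _ Ap).
Qed.

Lemma semidefinite_definite S : semidefinite S -> indefinite S -> False.
Proof. by case=> h [v [w [h1 h2]]]; [have := h v | have := h w]; lra. Qed.

(** In the basis [p, q, x] the form has zero last row and column; if the remaining block is
    singular, the matrix is an outer product, of rank at most 1. *)
Lemma minor2_rank2 (M : 'M[R]_3) p q x : (forall i j, M i j = M j i) ->
  (forall i, \sum_j M i j * x j = 0) -> det3 p q x != 0 -> \rank M = 2 ->
  minor2 (fun i j => M i j) p q != 0.
Proof.
move=> sym ker D rk; apply/eqP => m0.
pose r (i : 'I_3) := if i == ord0 then p else if i == o1 then q else x.
pose B : 'M[R]_3 := \matrix_(i, j) r i j.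
(* Cross products over the determinant give the inverse of [B] by cofactors. *)
pose cr (u v : 'I_3 -> R) (i : 'I_3) : R := if i == ord0 then u o1 * v o2 - u o2 * v o1
  else if i == o1 then u o2 * v ord0 - u ord0 * v o2 else u ord0 * v o1 - u o1 * v ord0.
pose C : 'M[R]_3 := \matrix_(i, j) (cr (r (if j == ord0 then o1 else if j == o1 then o2 else ord0))
   (r (if j == ord0 then o2 else if j == o1 then ord0 else o1)) i / det3 p q x).
have BC : B *m C = 1%:M.
  apply/matrixP => i j; rewrite !mxE sum3 !mxE /=.
  move: j; apply: ord3P; move: i; apply: ord3P; rewrite /cr /r /= ?mulr1n ?mulr0n;
    move: D; rewrite /det3 => D; by field.
have [Bu _] := mulmx1_unit BC.
have Bf : row_free B by rewrite row_free_unit.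
pose N := B *m M *m B^T.
have rN : \rank N = 2.
  rewrite /N mxrankMfree ?row_free_unit ?unitmx_tr //.
  by rewrite -mxrank_tr trmx_mul mxrankMfree ?mxrank_tr // row_free_unit unitmx_tr.
have NE i j : N i j = bil (fun i j => M i j) (r i) (r j).
  rewrite /N /bil !mxE exchange_big /=; apply: eq_bigr => k _; rewrite !mxE big_distrl /=.
  by apply: eq_bigr => l _; rewrite !mxE.
have bx v : bil (fun i j => M i j) v x = 0.
  rewrite /bil big1 // => i _; under eq_bigr do rewrite -mulrA.
  by rewrite -big_distrr /= ker mulr0.
have sb v w := bil_sym v w (S := fun i j => M i j) sym.
suff : (\rank N <= 1)%N by rewrite rN.
have outer (c w : 'I_3 -> R) : (forall i j, N i j = c i * w j) -> (\rank N <= 1)%N.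
  move=> NE'; have -> : N = (\col_i c i) *m (\row_j w j).
    by apply/matrixP => i j; rewrite NE' !mxE big_ord1 !mxE.
  exact: leq_trans (mxrankM_maxl _ _) (rank_leq_col _).
have [A0|A0] := eqVneq (bil (fun i j => M i j) p p) 0.
  have B0 : bil (fun i j => M i j) p q = 0.
    move: m0; rewrite /minor2 A0 mul0r sub0r (sb q p) => /eqP.
    by rewrite oppr_eq0 mulf_eq0 orbb => /eqP.
  apply: (outer (fun i => (i == o1)%:R) (fun j => (j == o1)%:R * bil (fun i j => M i j) q q)).
  move=> i j; rewrite NE; move: j; apply: ord3P; move: i; apply: ord3P;
    rewrite /r /= ?bx ?(sb x) ?bx ?(sb q p) ?A0 ?B0; ring.
apply: (outer (fun i => bil (fun i j => M i j) (r i) p)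
   (fun j => bil (fun i j => M i j) p (r j) / bil (fun i j => M i j) p p)).
move=> i j; rewrite NE; move: j; apply: ord3P; move: i; apply: ord3P;
  rewrite /r /= ?bx ?(sb x) ?bx ?mul0r ?mulr0 //; try by field.
move: m0; rewrite /minor2 => /eqP; rewrite subr_eq0 => /eqP m0.
by apply: (mulfI A0); rewrite m0; field.
Qed.

End SymForm.

Lemma proj_eq_sym (K : fieldType) (x y : 'I_3 -> K) : proj_eq x y -> proj_eq y x.
Proof.
by case=> l l0 E; exists l^-1 => [|i]; rewrite ?invr_eq0 // E mulrA mulVf // mul1r.
Qed.

Lemma proj_eq_trans (K : fieldType) (x y z : 'I_3 -> K) :
  proj_eq x y -> proj_eq y z -> proj_eq x z.
Proof.
case=> l l0 E [k k0 E']; exists (k * l) => [|i]; first by rewrite mulf_neq0.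
by rewrite E' E mulrA.
Qed.

Lemma exists_det3 (K : fieldType) (x : 'I_3 -> K) : nonzero_pt x ->
  exists p q, det3 p q x != 0.
Proof.
case=> i xi; pose e (k j : 'I_3) : K := (j == k)%:R; move: i xi; apply: ord3P => xi.
- exists (e o1), (e o2); rewrite /det3 /e /=.
  by rewrite (_ : _ + _ = x ord0) //; ring.
- exists (e o2), (e ord0); rewrite /det3 /e /=.
  by rewrite (_ : _ + _ = x o1) //; ring.
- exists (e ord0), (e o1); rewrite /det3 /e /=.
  by rewrite (_ : _ + _ = x o2) //; ring.
Qed.

Lemma bil_wedge (K : fieldType) (M : 'I_3 -> 'I_3 -> K) (a b u v : 'I_3 -> K) :
  (forall i j, M i j = a j * b i - b j * a i) ->
  bil M u v = dot3 b u * dot3 a v - dot3 a u * dot3 b v.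
Proof. by move=> E; rewrite /bil /dot3 !sum3 !E; ring. Qed.

Lemma bilZ (K : fieldType) (M S : 'I_3 -> 'I_3 -> K) (k : K) u v :
  (forall i j, M i j = k * S i j) -> bil M u v = k * bil S u v.
Proof.
move=> E; rewrite /bil big_distrr; apply: eq_bigr => i _; rewrite big_distrr.
by apply: eq_bigr => j _; rewrite E /=; ring.
Qed.

Lemma sing_pt_scale (K : fieldType) d (H : {mpoly K[3]}) x y : H \is d.-homog ->
  proj_eq x y -> sing_pt H x -> sing_pt H y.
Proof.
move=> hH [l l0 E] [[i xi] h0 h1]; have -> : y = fun i => l * x i by apply: funext.
split; first by exists i; rewrite mulf_neq0.
  by rewrite (dhomog_scale _ _ hH) h0 mulr0.
by move=> j; rewrite (dhomog_scale _ _ (dhomog_mderiv j hH)) h1 mulr0.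
Qed.

(** * Real points and complex conjugation *)

Section RealComplex.
Variable R : realType.
Implicit Types (H : {mpoly R[3]}) (x y : 'I_3 -> R).

Lemma toC_eval H x : (toC H).@[cpt x] = real_complex R H.@[x].
Proof. exact: meval_map_mpoly. Qed.

Lemma toC_homog d H : H \is d.-homog -> toC H \is d.-homog.
Proof.
move=> /dhomogP hH; apply/dhomogP => m; rewrite mcoeff_msupp mcoeff_map_mpoly fmorph_eq0.
by rewrite -mcoeff_msupp; apply: hH.
Qed.

Lemma toC_deriv H i : (toC H)^`M(i) = toC H^`M(i).
Proof. exact: mderiv_map_mpoly. Qed.

Lemma nonzero_cpt x : nonzero_pt (cpt x) <-> nonzero_pt x.
Proof. by split=> -[i xi]; exists i; move: xi; rewrite fmorph_eq0. Qed.

Lemma sing_toC H x : sing_pt (toC H) (cpt x) <-> sing_pt H x.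
Proof.
split=> -[nz h0 h1]; (split; first exact/nonzero_cpt).
- by apply: (@complexI R); rewrite -toC_eval h0.
- by move=> i; apply: (@complexI R); rewrite -toC_eval -toC_deriv h1.
- by rewrite toC_eval h0 rmorph0.
- by move=> i; rewrite toC_deriv toC_eval h1 rmorph0.
Qed.

Lemma hessian_toC H x : hessian (toC H) (cpt x) = map_mx (real_complex R) (hessian H x).
Proof. by apply/matrixP => i j; rewrite !mxE !toC_deriv toC_eval. Qed.

Lemma node_toC H x : node_pt (toC H) (cpt x) <-> node_pt H x.
Proof. by rewrite /node_pt hessian_toC mxrank_map; split=> -[/sing_toC]. Qed.

Lemma proj_eq_cpt x y : nonzero_pt x -> nonzero_pt y -> proj_eq (cpt x) (cpt y) -> proj_eq x y.
Proof.
move=> [i xi] [k yk] [l l0 E]; pose m := y i / x i.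
have lE : l = real_complex R m.
  have ci : real_complex R (x i) != 0 by rewrite fmorph_eq0.
  apply: (mulIf ci); have := E i; rewrite /cpt => <-.
  by rewrite -rmorphM /m divfK.
exists m; first by move: l0; rewrite lE fmorph_eq0.
move=> j; apply: (@complexI R); have := E j; rewrite /cpt lE => ->.
by rewrite -rmorphM.
Qed.

Lemma cpt_proj_eq x y : proj_eq x y -> proj_eq (cpt x) (cpt y).
Proof.
case=> l l0 E; exists (real_complex R l); first by rewrite fmorph_eq0.
by move=> i; rewrite /cpt E -rmorphM.
Qed.

Lemma toC_conj H (p : 'I_3 -> R[i]) : (toC H).@[fun i => conjc (p i)] = conjc (toC H).@[p].
Proof.
exact: (meval_map_fixed H p (@conjc_real R)).
Qed.

Lemma sing_conj H p : sing_pt (toC H) p -> sing_pt (toC H) (fun i => conjc (p i)).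
Proof.
move=> [[i pi] h0 h1]; split; first by exists i; rewrite fmorph_eq0.
  by rewrite toC_conj h0 conjc0.
by move=> j; rewrite toC_deriv toC_conj -toC_deriv h1 conjc0.
Qed.

(** Division by a nonzero coordinate cancels the factor [l] and leaves coordinates fixed by
    conjugation. *)
Lemma proj_conj_real (p : 'I_3 -> R[i]) : nonzero_pt p ->
  proj_eq p (fun i => conjc (p i)) -> real_pt p.
Proof.
move=> [i pi] [l l0 E].
exists (fun j => complex.Re (p j / p i)); exists (p i) => // j; rewrite /cpt.
suff -> : real_complex R (complex.Re (p j / p i)) = p j / p i by rewrite mulrC divfK.
have : conjc (p j / p i) = p j / p i.
  by rewrite rmorphM fmorphV /= !E -mulf_div divff // mul1r.
by case: (p j / p i) => a b [] /eqP; rewrite -subr_eq0 -opprD oppr_eq0 -mulr2n mulrn_eq0 /= => /eqP->.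
Qed.

End RealComplex.

(** * The vector field of a pencil *)

Section Pencil.
Variables (R : realType) (d : nat) (F G : {mpoly R[3]}).
Hypothesis d0 : (0 < d)%N.
Hypothesis hF : F \is d.-homog.
Hypothesis hG : G \is d.-homog.
Implicit Types x y : 'I_3 -> R.

Definition member (s t : R) : {mpoly R[3]} := s *: F + t *: G.
Definition rbase x := (F.@[x] == 0) && (G.@[x] == 0).
Definition pfield (i : 'I_3) : {mpoly R[3]} := F * G^`M(i) - G * F^`M(i).

Lemma pfield_homog i : pfield i \is (d + d.-1).-homog.
Proof. by rewrite rpredB // dhomogM // dhomog_mderiv. Qed.

Lemma pfield_eval x i : (pfield i).@[x] = F.@[x] * G^`M(i).@[x] - G.@[x] * F^`M(i).@[x].
Proof. by rewrite mevalB !mevalM. Qed.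

Lemma pfield_jac x i j : jac pfield x i j =
  F^`M(j).@[x] * G^`M(i).@[x] + F.@[x] * G^`M(i)^`M(j).@[x]
  - (G^`M(j).@[x] * F^`M(i).@[x] + G.@[x] * F^`M(i)^`M(j).@[x]).
Proof. by rewrite /jac mderivB !mderivM mevalB !mevalD !mevalM. Qed.

Lemma pfield_tang x : dot3 (fun i => (pfield i).@[x]) x = 0.
Proof.
have eF := dhomog_euler x hF; have eG := dhomog_euler x hG.
transitivity (F.@[x] * (\sum_i x i * G^`M(i).@[x]) - G.@[x] * (\sum_i x i * F^`M(i).@[x])).
  by rewrite /dot3 !sum3 !pfield_eval; ring.
by rewrite eF eG; ring.
Qed.

Lemma pfield_ker x : vf_zero pfield x -> forall i, \sum_j jac pfield x i j * x j = 0.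
Proof.
move=> z i; under eq_bigr do rewrite mulrC.
by rewrite (dhomog_euler x (pfield_homog i)) z mulr0.
Qed.

Lemma member_homog s t : member s t \is d.-homog.
Proof. by rewrite rpredD // rpredZ. Qed.

Lemma member_eval s t x : (member s t).@[x] = s * F.@[x] + t * G.@[x].
Proof. by rewrite mevalD !mevalZ. Qed.

Lemma member_deriv s t i : (member s t)^`M(i) = s *: F^`M(i) + t *: G^`M(i).
Proof. by rewrite mderivD !mderivZ. Qed.

Lemma member_hess s t x i j :
  hessian (member s t) x i j = s * F^`M(i)^`M(j).@[x] + t * G^`M(i)^`M(j).@[x].
Proof. by rewrite mxE member_deriv mderivD !mderivZ mevalD !mevalZ. Qed.

Lemma hess_sym s t x i j : hessian (member s t) x i j = hessian (member s t) x j i.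
Proof. by rewrite !mxE mderiv_comm. Qed.

Lemma hess_ker s t x : sing_pt (member s t) x ->
  forall i, \sum_j hessian (member s t) x i j * x j = 0.
Proof.
move=> [_ _ h] i; under eq_bigr do rewrite mxE mulrC.
by rewrite (dhomog_euler x (dhomog_mderiv i (member_homog s t))) h mulr0.
Qed.

Lemma sing_coef s t x : (s != 0) || (t != 0) -> sing_pt (member s t) x -> ~~ rbase x ->
  exists2 k, k != 0 & F.@[x] = k * t /\ G.@[x] = - (k * s).
Proof.
move=> st [_ h _] nb; move: h; rewrite member_eval => h.
suff [k [k1 k2]] : exists k, F.@[x] = k * t /\ G.@[x] = - (k * s).
  exists k; last by split.
  by apply: contraNneq nb => k0; rewrite /rbase k1 k2 k0 !mul0r oppr0 eqxx.
have [t0|t0] := eqVneq t 0.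
  move: st h; rewrite t0 eqxx orbF mul0r addr0 => s0 /eqP.
  rewrite mulf_eq0 (negbTE s0) /= => /eqP F0.
  by exists (- (G.@[x] / s)); rewrite F0 mulr0; split=> //; field.
exists (F.@[x] / t); split; first by rewrite divfK.
have tG : t * G.@[x] = - (s * F.@[x]) by apply/eqP; rewrite -addr_eq0 addrC h.
by apply: (mulfI t0); rewrite tG; field.
Qed.

Lemma sing_vf_zero s t x : (s != 0) || (t != 0) -> sing_pt (member s t) x -> ~~ rbase x ->
  vf_zero pfield x.
Proof.
move=> st sg nb i; have [k _ [kF kG]] := sing_coef st sg nb; have [_ _ /(_ i)] := sg.
rewrite member_deriv mevalD !mevalZ pfield_eval kF kG => h.
by rewrite -(mulr0 k) -h; ring.
Qed.

Lemma sing_jac s t x : (s != 0) || (t != 0) -> sing_pt (member s t) x -> ~~ rbase x ->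
  exists2 k, k != 0 & forall i j, jac pfield x i j = k * hessian (member s t) x i j.
Proof.
move=> st sg nb; have [k k0 [kF kG]] := sing_coef st sg nb; exists k => // i j.
have [_ _ h] := sg.
(* The two gradients are linearly dependent at the singular point, so the first order products
   cancel and only second derivatives remain. *)
have dep : F^`M(j).@[x] * G^`M(i).@[x] = G^`M(j).@[x] * F^`M(i).@[x].
  have hi := h i; have hj := h j; move: hi hj; rewrite !member_deriv !mevalD !mevalZ.
  set a := F^`M(i).@[x]; set b := F^`M(j).@[x]; set c := G^`M(i).@[x]; set e := G^`M(j).@[x].
  move=> hi hj; case/orP: st => z0; apply: (mulfI z0); apply/eqP; rewrite -subr_eq0.
    have -> : s * (b * c) - s * (e * a) = (s * b + t * e) * c - (s * a + t * c) * e by ring.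
    by rewrite hi hj !mul0r subrr.
  have -> : t * (b * c) - t * (e * a) = (s * a + t * c) * b - (s * b + t * e) * a by ring.
  by rewrite hi hj !mul0r subrr.
by rewrite pfield_jac member_hess dep kF kG; ring.
Qed.

Lemma vf_zero_sing x : nonzero_pt x -> vf_zero pfield x ->
  sing_pt (member G.@[x] (- F.@[x])) x.
Proof.
move=> nz z; split=> //; first by rewrite member_eval; ring.
by move=> i; have := z i; rewrite pfield_eval member_deriv mevalD !mevalZ => h; rewrite -[RHS]oppr0 -h; ring.
Qed.

Lemma rbase_scale x y : proj_eq x y -> rbase x = rbase y.
Proof.
move=> [l l0 E]; have -> : y = fun i => l * x i by apply: funext.
by rewrite /rbase !(dhomog_scale _ _ hF, dhomog_scale _ _ hG) !mulf_eq0 expf_eq0 (negbTE l0) andbF.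
Qed.

Lemma hess_scale s t x y : proj_eq x y -> exists2 k, k != 0 &
  forall v w, bil (fun i j => hessian (member s t) y i j) v w
     = k * bil (fun i j => hessian (member s t) x i j) v w.
Proof.
move=> [l l0 E]; have -> : y = fun i => l * x i by apply: funext.
exists (l ^+ d.-1.-1) => [|v w]; first by rewrite expf_neq0.
apply: bilZ => i j.
by rewrite !mxE (dhomog_scale _ _ (dhomog_mderiv j (dhomog_mderiv i (member_homog s t)))).
Qed.

Lemma indefinite_scale (S T : 'I_3 -> 'I_3 -> R) k : k != 0 ->
  (forall v w, bil T v w = k * bil S v w) -> indefinite S -> indefinite T.
Proof.
move=> k0 E [v [w [h1 h2]]]; have [kn|kp|k00] := ltrgtP k 0; last by rewrite k00 eqxx in k0.
  by exists w, v; rewrite !E; split; nra.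
by exists v, w; rewrite !E; split; nra.
Qed.

Lemma semidefinite_scale (S T : 'I_3 -> 'I_3 -> R) k : k != 0 ->
  (forall v w, bil T v w = k * bil S v w) -> semidefinite S -> semidefinite T.
Proof.
move=> k0 E; have [kn|kp|k00] := ltrgtP k 0; last by rewrite k00 eqxx in k0.
  by case=> h; [right|left] => v; rewrite E; have := h v; nra.
by case=> h; [left|right] => v; rewrite E; have := h v; nra.
Qed.

Hypothesis Hsing : forall s t : R, (s != 0) || (t != 0) -> forall x, sing_pt (member s t) x ->
  [/\ node_pt (member s t) x, ~~ rbase x & forall y, sing_pt (member s t) y -> proj_eq x y].

(** One frame is enough to define the sign; [pfield_ndeg] shows that all frames agree. *)
Definition pos_index x := exists p q, det3 p q x != 0 /\ 0 < minor2 (jac pfield x) p q.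
Definition idx x : int := if `[< pos_index x >] then 1 else -1.

(** The Jacobian is the wedge of the two gradients, so the minor is the square of their determinant
    on [p, q]. *)
Lemma minor2_base x p q : rbase x -> det3 p q x != 0 -> 0 < minor2 (jac pfield x) p q.
Proof.
move=> /andP[/eqP Fx /eqP Gx] D.
have nz := det3_nonzero D.
set a := fun i => F^`M(i).@[x]; set b := fun i => G^`M(i).@[x].
have B u v : bil (jac pfield x) u v = dot3 b u * dot3 a v - dot3 a u * dot3 b v.
  by apply: bil_wedge => i j; rewrite pfield_jac Fx Gx /a /b; ring.
have ax : dot3 a x = 0.
  rewrite /dot3; under eq_bigr do rewrite mulrC.
  by rewrite (dhomog_euler x hF) Fx mulr0.
have bx : dot3 b x = 0.
  rewrite /dot3; under eq_bigr do rewrite mulrC.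
  by rewrite (dhomog_euler x hG) Gx mulr0.
pose A := dot3 a p; pose A' := dot3 a q; pose C := dot3 b p; pose C' := dot3 b q.
suff N : C * A' - A * C' != 0.
  rewrite /minor2 !B -/A -/A' -/C -/C' [ltRHS](_ : _ = (C * A' - A * C') ^+ 2); last by ring.
  by rewrite exprn_even_gt0.
apply/eqP => N0.
(* Dependent gradients at a base point would make some member singular there. *)
have bad s t : (s != 0) || (t != 0) -> s * A + t * C = 0 -> s * A' + t * C' = 0 -> False.

  move=> st e1 e2; pose w i := s * a i + t * b i.
  have w0 : forall i, w i = 0.
    apply: (dot3_eq0 D).
    - by rewrite -e1 /A /C /w /dot3 !sum3; ring.
    - by rewrite -e2 /A' /C' /w /dot3 !sum3; ring.
    - have -> : dot3 w x = s * dot3 a x + t * dot3 b x by rewrite /w /dot3 !sum3; ring.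
      by rewrite ax bx !mulr0 addr0.
  have sg : sing_pt (member s t) x.
    split=> //; first by rewrite member_eval Fx Gx !mulr0 addr0.
    by move=> i; rewrite member_deriv mevalD !mevalZ; exact: w0.
  have [_ nb _] := Hsing st sg.
  by move: nb; rewrite /rbase Fx Gx eqxx.
(* The combination [(C, - A)] vanishes on [p] identically and on [q] by [N0]. When it is trivial,
   [(C', - A')] serves, and failing that [F] itself. *)
have [A0|A0] := eqVneq A 0; last first.
  by apply: (bad C (- A)); rewrite ?oppr_eq0 ?A0 ?orbT //; [ring|rewrite -N0; ring].
have [C0|C0] := eqVneq C 0; last first.
  by apply: (bad C (- A)); rewrite ?C0 //; [ring|rewrite -N0; ring].
have [A'0|A'0] := eqVneq A' 0; last first.
  by apply: (bad C' (- A')); rewrite ?oppr_eq0 ?A'0 ?orbT ?A0 ?C0 //; ring.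
by apply: (bad 1 0); rewrite ?oner_eq0 ?A0 ?A'0 //; ring.
Qed.

Lemma minor2_sing s t x p q : (s != 0) || (t != 0) -> sing_pt (member s t) x ->
  det3 p q x != 0 ->
  let S := fun i j => hessian (member s t) x i j in
  [/\ minor2 (jac pfield x) p q != 0,
   0 < minor2 (jac pfield x) p q -> semidefinite S &
   minor2 (jac pfield x) p q < 0 -> indefinite S].
Proof.
move=> st sg D S; have [[_ rk] nb _] := Hsing st sg.
have sym : forall i j, S i j = S j i by exact: hess_sym.
have ker : forall i, \sum_j S i j * x j = 0 by exact: hess_ker.
have [k k0 kE] := sing_jac st sg nb.
have ->: minor2 (jac pfield x) p q = k ^+ 2 * minor2 S p q.
  by rewrite /minor2 !(bilZ _ _ kE); ring.
have k2 : 0 < k ^+ 2 by rewrite exprn_even_gt0.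
have N := minor2_rank2 sym ker D rk.
split; first by rewrite mulf_neq0 // gt_eqF.
  by rewrite pmulr_rgt0 //; apply: minor2_gt0_semidefinite ker D.
by rewrite pmulr_rlt0 //; apply: minor2_lt0_indefinite.
Qed.

Lemma base_idx x : nonzero_pt x -> rbase x -> idx x = 1.
Proof.
move=> /exists_det3[p [q D]] b; rewrite /idx; case: asboolP => // -[].
by exists p, q; split=> //; apply: minor2_base.
Qed.

Lemma sing_idx s t x : (s != 0) || (t != 0) -> sing_pt (member s t) x ->
  let S := fun i j => hessian (member s t) x i j in
  (idx x = 1 /\ semidefinite S) \/ (idx x = -1 /\ indefinite S).
Proof.
move=> st sg S; rewrite /idx; case: asboolP => [[p [q [D h]]]|np].
  by left; split=> //; have [_ + _] := minor2_sing st sg D; apply.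
right; split=> //; have [nz _ _] := sg; have [p [q D]] := exists_det3 nz.
have [n0 _] := minor2_sing st sg D; apply; rewrite lt_neqAle n0 /= leNgt.
by apply/negP => h; apply: np; exists p, q.
Qed.

(** Independence of the frame is read off the tangent cone: a semidefinite Hessian excludes a
    negative minor and an indefinite one a positive minor, for every [p, q]. At base points the
    minor is always positive. *)
Lemma pfield_ndeg x p q : vf_zero pfield x -> det3 p q x != 0 ->
  minor2 (jac pfield x) p q != 0 /\ sgz (minor2 (jac pfield x) p q) = idx x.
Proof.
move=> z D; have nz := det3_nonzero D.
have [b|nb] := boolP (rbase x).
  by have h := minor2_base b D; rewrite gt_eqF // (gtr0_sgz h) base_idx.
have st : (G.@[x] != 0) || (- F.@[x] != 0) by move: nb; rewrite oppr_eq0 negb_and orbC.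
have sg := vf_zero_sing nz z; have [n0 hp hn] := minor2_sing st sg D.
split=> //; have [[-> sd]|[-> ind]] := sing_idx st sg.
  move: n0; rewrite neq_lt => /orP[h|h]; last by rewrite gtr0_sgz.
  by have := semidefinite_definite sd (hn h).
move: n0; rewrite neq_lt => /orP[h|h]; first by rewrite ltr0_sgz.
by have := semidefinite_definite (hp h) ind.
Qed.

Lemma pfield_index_sum : exists n (P : 'I_n -> 'I_3 -> R),
  [/\ forall i, nonzero_pt (P i) /\ vf_zero pfield (P i),
      forall i j, proj_eq (P i) (P j) -> i = j,
      forall x, nonzero_pt x -> vf_zero pfield x -> exists i, proj_eq (P i) x &
      \sum_i idx (P i) = 1].
Proof.
apply: (@index_sum _ _ (d + d.-1)%N).
- exact: pfield_tang.
- by rewrite -[X in (X + _)%N](prednK d0) addSn /= addnn odd_double.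
- by move=> l x i; apply: dhomog_scale (pfield_homog i).
- exact: pfield_ker.
- exact: pfield_ndeg.
Qed.

End Pencil.

(** * Counting real members and base points *)

Lemma card_rel_le (A B : finType) (r : A -> B -> Prop) :
  (forall a, exists b, r a b) -> (forall a a' b, r a b -> r a' b -> a = a') ->
  (#|A| <= #|B|)%N.
Proof.
move=> ex inj; pose f a := projT1 (cid (ex a)).
have fP a : r a (f a) by rewrite /f; case: cid.
apply: (@leq_card _ _ f) => a a' E; apply: (inj _ _ (f a)) => //.
by rewrite E.
Qed.

Lemma sum_pred_card (T : finType) (p : pred T) :
  \sum_i (nat_of_bool (p i))%:Z = #|p|%:Z.
Proof.
rewrite -sum1_card [in RHS]big_mkcond (big_morph Posz PoszD (erefl 0%:Z)).
by apply: eq_bigr => i _; rewrite unfold_in; case: (p i).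
Qed.

Section Members.
Variables (R : realType) (d : nat) (F G : {mpoly R[3]}).
Hypothesis hF : F \is d.-homog.
Hypothesis hG : G \is d.-homog.
Hypothesis HC : forall s t : R[i], (s != 0) || (t != 0) ->
  forall p, sing_pt (cmember F G s t) p ->
    [/\ node_pt (cmember F G s t) p, ~ base_pt F G p
      & forall q, sing_pt (cmember F G s t) q -> proj_eq p q].

Definition mem_s (o : option R) : R := if o is Some _ then 1 else 0.
Definition mem_t (o : option R) : R := if o is Some t then t else 1.

Lemma rmemberE o : rmember F G o = member F G (mem_s o) (mem_t o).
Proof. by case: o => [t|] /=; rewrite /member ?scale1r // scale0r add0r. Qed.

Lemma mem_st o : (mem_s o != 0) || (mem_t o != 0).
Proof. by case: o => [t|] /=; rewrite oner_eq0 ?orbT. Qed.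

Lemma toC_member s t :
  toC (member F G s t) = cmember F G (real_complex R s) (real_complex R t).
Proof. by rewrite /toC /member raddfD /= !map_mpolyZ. Qed.

Lemma real_st (s t : R) : (s != 0) || (t != 0) ->
  (real_complex R s != 0) || (real_complex R t != 0).
Proof. by rewrite !fmorph_eq0. Qed.

Lemma base_cpt x : nonzero_pt x -> rbase F G x -> base_pt F G (cpt x).
Proof.
move=> nz /andP[/eqP h1 /eqP h2]; split; first exact/nonzero_cpt.
  by rewrite toC_eval h1.
by rewrite toC_eval h2.
Qed.

Lemma real_sing (s t : R) : (s != 0) || (t != 0) -> forall x, sing_pt (member F G s t) x ->
  [/\ node_pt (member F G s t) x, ~~ rbase F G x &
      forall y, sing_pt (member F G s t) y -> proj_eq x y].
Proof.
move=> st x sg; have [nz _ _] := sg; have := sg; move/sing_toC; rewrite toC_member => sgC.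
have [nd nb un] := HC (real_st st) sgC; split.
- by apply/node_toC; rewrite toC_member.
- by apply/negP => b; apply: nb; apply: base_cpt.
- move=> y sy; have [ny _ _] := sy; apply: proj_eq_cpt => //.
  by apply: un; rewrite -toC_member; apply/sing_toC.
Qed.

(** Parameter of the only member through a point off the base locus. *)
Definition mem_of (x : 'I_3 -> R) : option R :=
  if G.@[x] != 0 then Some (- (F.@[x] / G.@[x])) else None.

Lemma mem_of_sing x : nonzero_pt x -> vf_zero (pfield F G) x -> ~~ rbase F G x ->
  sing_pt (rmember F G (mem_of x)) x.
Proof.
move=> nz z nb; rewrite /mem_of; have [G0|G0] := eqVneq G.@[x] 0 => /=.
  have F0 : F.@[x] != 0 by move: nb; rewrite /rbase G0 eqxx andbT.
  split=> // i; have := z i; rewrite pfield_eval G0 mul0r subr0 => /eqP.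
  by rewrite mulf_eq0 (negbTE F0) => /eqP.
split=> // [|i]; first by rewrite mevalD mevalZ; field.
have := z i; rewrite pfield_eval mderivD mderivZ mevalD mevalZ => h.
have -> : F^`M(i).@[x] + - (F.@[x] / G.@[x]) * G^`M(i).@[x] =
  - (F.@[x] * G^`M(i).@[x] - G.@[x] * F^`M(i).@[x]) / G.@[x] by field.
by rewrite h oppr0 mul0r.
Qed.

Lemma mem_of_unique o x : sing_pt (rmember F G o) x -> ~~ rbase F G x -> mem_of x = o.
Proof.
move=> [_ + _]; rewrite /rbase /mem_of; case: o => [t|] /=; last by move->; rewrite eqxx.
rewrite mevalD mevalZ => h; have [G0|G0] := eqVneq G.@[x] 0 => /=.
  by move: h; rewrite G0 mulr0 addr0 => ->; rewrite eqxx.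
move=> _; congr Some; apply: (mulIf G0); rewrite mulNr divfK //.
by apply/eqP; rewrite eq_sym -addr_eq0 addrC h.
Qed.

Lemma rsing o x : sing_pt (rmember F G o) x ->
  [/\ node_pt (rmember F G o) x, ~~ rbase F G x, vf_zero (pfield F G) x &
      forall y, sing_pt (rmember F G o) y -> proj_eq x y].
Proof.
rewrite rmemberE => sg; have [h1 h2 h3] := real_sing (mem_st o) sg; split=> //.
exact: sing_vf_zero (mem_st o) sg h2.
Qed.

(** Conjugation permutes the singular points of a real member; there is only one, so it is fixed and
    hence a real point. *)
Lemma sing_real o p : sing_pt (toC (rmember F G o)) p ->
  exists2 q, sing_pt (rmember F G o) q & proj_eq (cpt q) p.
Proof.
rewrite rmemberE => sg; have sgJ := sing_conj sg; have [nz _ _] := sg.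
move: (sg) (sgJ); rewrite toC_member => sg' sgJ'.
have [_ _ un] := HC (real_st (mem_st o)) sg'.
have [q qp] := proj_conj_real nz (un _ sgJ').
exists q => //; apply/sing_toC.
exact: (sing_pt_scale (toC_homog (member_homog hF hG _ _)) (proj_eq_sym qp) sg).
Qed.

(** Proportionality matches the base points among the zeros [P i] with the list [Br], injectively in
    both directions. *)
Lemma pencil_count (r : nat) (Br Bn : seq ('I_3 -> R[i])) :
  size (Br ++ Bn) = (d ^ 2)%N -> size Bn = (2 * r)%N ->
  (forall i, (i < size (Br ++ Bn))%N -> base_pt F G (nth (fun _ => 0) (Br ++ Bn) i)) ->
  (forall i j, (i < size (Br ++ Bn))%N -> (j < size (Br ++ Bn))%N -> i <> j ->
     ~ proj_eq (nth (fun _ => 0) (Br ++ Bn) i) (nth (fun _ => 0) (Br ++ Bn) j)) ->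
  (forall p, base_pt F G p ->
     exists2 i, (i < size (Br ++ Bn))%N & proj_eq (nth (fun _ => 0) (Br ++ Bn) i) p) ->
  (forall i, (i < size Br)%N -> real_pt (nth (fun _ => 0) Br i)) ->
  (forall i, (i < size Bn)%N -> ~ real_pt (nth (fun _ => 0) Bn i)) ->
  forall n (P : 'I_n -> 'I_3 -> R),
  (forall i, nonzero_pt (P i) /\ vf_zero (pfield F G) (P i)) ->
  (forall i j, proj_eq (P i) (P j) -> i = j) ->
  (forall x, nonzero_pt x -> vf_zero (pfield F G) x -> exists i, proj_eq (P i) x) ->
  (#|[pred i | rbase F G (P i)]| + 2 * r = d ^ 2)%N.
Proof.
move=> sz szn Bb Bd Bc Brr Bnr n P Pz Pinj Pall; set b := [pred i | _].
suff -> : #|b| = size Br by rewrite -szn -size_cat.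
pose nt := nth (fun _ : 'I_3 => 0 : R[i]).
have ltBr (k : 'I_(size Br)) : (k < size (Br ++ Bn))%N.
  by rewrite size_cat; apply: leq_trans (ltn_ord k) (leq_addr _ _).
have ntE (k : 'I_(size Br)) : nt (Br ++ Bn) k = nt Br k by rewrite /nt nth_cat ltn_ord.
rewrite -(card_sig b) -[RHS]card_ord; apply/eqP; rewrite eqn_leq; apply/andP; split.
- apply: (@card_rel_le {x : 'I_n | b x} 'I_(size Br)
    (fun i k => proj_eq (nt Br k) (cpt (P (val i))))).
    move=> [i bi]; have [nz _] := Pz i; have [k kB E] := Bc _ (base_cpt nz bi).
    have [kr|kr] := ltnP k (size Br).
      by exists (Ordinal kr); rewrite /=; move: E; rewrite nth_cat kr.
    (* An index past [Br] would make the real point [P i] represent a non-real base point. *)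
    case: (Bnr (k - size Br)%N); first by move: kB; rewrite size_cat; lia.
    by exists (P i); apply: proj_eq_sym; move: E; rewrite nth_cat ltnNge kr.
  move=> i i' k /proj_eq_sym E1 E2; apply: val_inj; apply: Pinj.
  by apply: proj_eq_cpt (proj_eq_trans E1 E2); case: (Pz (val i)); case: (Pz (val i')).
- apply: (@card_rel_le 'I_(size Br) {x : 'I_n | b x}
    (fun k i => proj_eq (nt Br k) (cpt (P (val i))))).
    move=> k; have [q qE] := Brr k (ltn_ord k).
    have [nz h1 h2] := Bb k (ltBr k); rewrite -/nt ntE in nz h1 h2.
    have kE : nt Br k = fun i => projT1 (cid2 qE) * cpt q i.
      by apply: funext => i; case: (cid2 qE).
    have l0 : projT1 (cid2 qE) != 0 by case: (cid2 qE).
    move: kE l0; move: (projT1 _) => l kE l0.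
    have zero (H : {mpoly R[3]}) : H \is d.-homog -> (toC H).@[nt Br k] = 0 -> H.@[q] == 0.
      move=> hH; rewrite kE (dhomog_scale _ _ (toC_homog hH)) toC_eval => /eqP.
      by rewrite mulf_eq0 expf_eq0 (negbTE l0) andbF fmorph_eq0.
    have bq : rbase F G q by rewrite /rbase (zero _ hF h1) (zero _ hG h2).
    have nq : nonzero_pt q.
      case: nz => i; rewrite kE mulf_eq0 negb_or => /andP[_ qi].
      by apply/nonzero_cpt; exists i.
    have zq : vf_zero (pfield F G) q.
      by case/andP: bq => /eqP F0 /eqP G0 i; rewrite pfield_eval F0 G0 !mul0r subrr.
    have [i iq] := Pall q nq zq.
    have bi : b i by rewrite /b /= (rbase_scale hF hG iq).
    exists (exist _ i bi) => /=; apply: proj_eq_trans (proj_eq_sym qE) _.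
    by apply: cpt_proj_eq; apply: proj_eq_sym.
  move=> k k' i E1 /proj_eq_sym E2; apply: val_inj; apply: contrapT => kk.
  apply: (Bd k k' (ltBr k) (ltBr k') kk); rewrite -/nt !ntE.
  exact: proj_eq_trans E1 E2.
Qed.

End Members.

Theorem mainTheorem9 (R : realType) (d r : nat) (F G : {mpoly R[3]}) :
  (2 <= d)%N ->
  F \is d.-homog -> G \is d.-homog ->
  (* {sF + tG} is a genuine one-parameter family *)
  (forall a b : R, a *: F + b *: G = 0 -> a = 0 /\ b = 0) ->
  (* exactly d^2 distinct base points, of which exactly 2r are non-real *)
  (exists Br Bn : seq ('I_3 -> R[i]),
     size (Br ++ Bn) = (d ^ 2)%N /\ size Bn = (2 * r)%N /\
         (forall i, (i < size (Br ++ Bn))%N -> base_pt F G (nth (fun _ => 0) (Br ++ Bn) i)) /\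
         (forall i j, (i < size (Br ++ Bn))%N -> (j < size (Br ++ Bn))%N -> i <> j ->
            ~ proj_eq (nth (fun _ => 0) (Br ++ Bn) i) (nth (fun _ => 0) (Br ++ Bn) j)) /\
         (forall p, base_pt F G p ->
            exists2 i, (i < size (Br ++ Bn))%N & proj_eq (nth (fun _ => 0) (Br ++ Bn) i) p) /\
         (forall i, (i < size Br)%N -> real_pt (nth (fun _ => 0) Br i)) /\
       (forall i, (i < size Bn)%N -> ~ real_pt (nth (fun _ => 0) Bn i)))  ->
  (* every singular member has exactly one singular point, a node, not a base point *)
  (forall s t : R[i], (s != 0) || (t != 0) ->
     forall p, sing_pt (cmember F G s t) p ->
       [/\ node_pt (cmember F G s t) p, ~ base_pt F G p
         & forall q, sing_pt (cmember F G s t) q -> proj_eq p q]) ->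
  exists Scr Ssol : seq (option R),
    uniq Scr /\ uniq Ssol /\
        (forall x, x \in Scr <-> crossing_member F G x) /\
        (forall x, x \in Ssol <-> solitary_member F G x) /\
        ((size Scr)%:Z - (size Ssol)%:Z = (d ^ 2)%:Z - 1 - (2 * r)%:Z)%R /\
      (r = 0%N -> exists Snod : seq (option R),
           [/\ uniq Snod, (forall x, x \in Snod <-> nodal_member F G x)
             & (d ^ 2 - 1 <= size Snod)%N]).
Proof.
move=> d2 hF hG _ [Br [Bn [sz [szn [Bb [Bd [Bc [Brr Bnr]]]]]]]] HC.
have d0 : (0 < d)%N by lia.
have RS := real_sing HC.
have [n [P [Pz Pinj Pall Psum]]] := pfield_index_sum d0 hF hG RS.
have cnt := pencil_count hF hG sz szn Bb Bd Bc Brr Bnr Pz Pinj Pall.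
pose b i := rbase F G (P i).
pose mo i := mem_of F G (P i).
have sgi i : ~~ b i -> sing_pt (rmember F G (mo i)) (P i).
  by move=> nb; have [nz z] := Pz i; apply: mem_of_sing.
have find o x : sing_pt (rmember F G o) x ->
  exists i, [/\ ~~ b i, mo i = o, sing_pt (rmember F G o) (P i) & proj_eq x (P i)].
  move=> sg; have [nd nb z _] := rsing HC sg; have [nz _ _] := sg.
  have [i iP] := Pall x nz z; exists i; rewrite /b (rbase_scale hF hG iP).
  have sP : sing_pt (rmember F G o) (P i).
    move: sg; rewrite rmemberE; apply: (sing_pt_scale (member_homog hF hG _ _)).
    exact: proj_eq_sym.
  split=> //; last exact: proj_eq_sym.
  by apply: (mem_of_unique sP); rewrite (rbase_scale hF hG iP).
(* A member has one singular point, so counting singular real members amounts to counting zeros off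
   the base locus. *)
have moinj i j : ~~ b i -> ~~ b j -> mo i = mo j -> i = j.
  move=> bi bj E; have [_ _ _ un] := rsing HC (sgi i bi).
  by apply: Pinj; apply: un; rewrite E; apply: sgi.
have hidx o i : sing_pt (rmember F G o) (P i) ->
  let S := fun k l => hessian (rmember F G o) (P i) k l in
  (idx F G (P i) = 1 /\ semidefinite S) \/ (idx F G (P i) = -1 /\ indefinite S).
  by rewrite rmemberE => sg; apply: (sing_idx hF hG RS (mem_st o) sg).
pose cr := [pred i | ~~ b i && (idx F G (P i) == -1)].
pose so := [pred i | ~~ b i && (idx F G (P i) == 1)].
have uq (p : pred 'I_n) : (forall i, p i -> ~~ b i) -> uniq [seq mo i | i <- enum p].
  move=> H; rewrite map_inj_in_uniq ?enum_uniq // => i j; rewrite !mem_enum => pi pj.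
  by apply: moinj; apply: H.
exists [seq mo i | i <- enum cr], [seq mo i | i <- enum so].
have total : #|cr|%:Z - #|so|%:Z = (d ^ 2)%:Z - 1 - (2 * r)%:Z.
  have E : \sum_i idx F G (P i) = #|[pred i | rbase F G (P i)]|%:Z + #|so|%:Z - #|cr|%:Z.
    rewrite -!sum_pred_card -big_split /= -sumrB; apply: eq_bigr => i _.
    have [nz z] := Pz i; case bi : (b i); rewrite /= -/(b i) bi /=.
      by rewrite (base_idx hF hG RS nz) //; ring.
    by have [[-> _]|[-> _]] := hidx (mo i) i (sgi i (negbT bi)).
  by move: E; rewrite Psum; lia.
split; first by apply: uq => i /andP[].
split; first by apply: uq => i /andP[].
split.
  move=> x; split.
    case/mapP => i; rewrite mem_enum => /andP[bi /eqP Ei] ->.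
    have sg := sgi i bi; have [nd _ _ _] := rsing HC sg; exists (P i); split=> //.
    have [[E1 _]|[_ //]] := hidx _ i sg.
    by move: Ei; rewrite E1.
  case=> p [[sg _] ind]; have [i [bi mi sP pP]] := find x p sg.
  rewrite -mi map_f // mem_enum inE /= bi /=; apply/eqP.
  have [[_ sd]|[-> //]] := hidx x i sP.
  move: ind sd; rewrite rmemberE => ind sd.
  (* The Hessians at two representatives differ by a nonzero factor, possibly negative, which
     preserves both types. *)
  have [k k0 kE] := hess_scale hF hG (mem_s x) (mem_t x) pP.
  by case: (semidefinite_definite sd (indefinite_scale k0 kE ind)).
split.
  move=> x; split.
    case/mapP => i; rewrite mem_enum => /andP[bi /eqP Ei] ->.
    have sg := sgi i bi; have [nd _ _ _] := rsing HC sg; exists (P i); split=> //.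
    have [[_ //]|[E1 _]] := hidx _ i sg.
    by move: Ei; rewrite E1.
  case=> p [[sg _] sd]; have [i [bi mi sP pP]] := find x p sg.
  rewrite -mi map_f // mem_enum inE /= bi /=; apply/eqP.
  have [[-> //]|[_ ind]] := hidx x i sP.
  move: ind sd; rewrite rmemberE => ind sd.
  have [k k0 kE] := hess_scale hF hG (mem_s x) (mem_t x) pP.
  by case: (semidefinite_definite (semidefinite_scale k0 kE sd) ind).
split; first by rewrite !size_map -!cardE.
(* Every nodal real member has its node at a real zero, so all zeros off the base locus list these
   members; those of index -1 alone number at least [d ^ 2 - 1]. *)
move=> r0; exists [seq mo i | i <- enum [pred i | ~~ b i]]; split.
- by apply: uq.
- move=> x; split.
    case/mapP => i; rewrite mem_enum => bi ->.
    have [nd _ _ _] := rsing HC (sgi i bi); exists (cpt (P i)).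
    exact/node_toC.
  case=> p [sg _]; have [q sq _] := sing_real hF hG HC sg.
  by have [i [bi mi _ _]] := find x q sq; rewrite -mi map_f // mem_enum.
rewrite size_map -cardE.
have : (#|cr| <= #|[pred i | ~~ b i]|)%N by apply: subset_leq_card; apply/fintype.subsetP => i /andP[].
move: total; rewrite r0 muln0.
by move: (d ^ 2)%N #|cr| #|so| #|_| => e k l m; lia.
Qed.
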